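(* Let $\mathscr D$ be a b-quad-graph covering the whole unit disc $\mathbb D=\{z\in\mathbb C:|z|<1\}$ and let $\alpha:F(\mathscr D)\to(0,\pi)$ be an admissible labelling. Let $\mathscr C$ and $\widetilde{\mathscr C}$ be two locally finite (in $\mathbb D$) embedded infinite circle patterns for $\mathscr D$ and $\alpha$ which are contained in $\mathbb D$. Then there is a hyperbolic isometry $f:\mathbb D\to\mathbb D$ (of the Poincaré disc) such that $\widetilde{\mathscr C}=f(\mathscr C)$.
   Context: A b-quad-graph $\mathscr D$ is a strongly regular cell decomposition of (a domain in) $\mathbb C$ all of whose faces are quadrilaterals and whose 1-skeleton is bipartite; its vertices are colored white and black. The associated graph $G$ has the white vertices as vertices, two being joined by an edge iff they are incident to a common face of $\mathscr D$; thus edges of $G$ correspond to faces of $\mathscr D$, and a labelling $\alpha:F(\mathscr D)\to(0,\pi)$ is equivalently a function on $E(G)$. A labelling is admissible if at every interior black vertex the values of $\alpha$ on the incident faces sum to $2\pi$. A circle pattern for $\mathscr D$ and $\alpha$ consists of circles $\mathscr C(v)$, $v\in V(G)$, and closed kites $K_e$, $e\in E(G)$, all with the same orientation, such that for every edge $e=[v_1,v_2]$ the circles $\mathscr C(v_1),\mathscr C(v_2)$ intersect with exterior intersection angle $\alpha(e)$ (the exterior intersection angle is the angle at an intersection point between the radii to the two centers; the interior angle is $\pi-\alpha(e)$), the kite $K_e$ is the quadrilateral with vertices the two centers and the two intersection points (the intersection points corresponding to the two black vertices of the face $e$), and the kite pattern is locally isomorphic to $\mathscr D$ at every interior vertex.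 The pattern is embedded if distinct kites have disjoint interiors and two kites intersect in an edge or a vertex iff the corresponding faces of $\mathscr D$ share an edge or a vertex, respectively. A circle pattern is locally finite in $\mathbb D$ if every compact subset of $\mathbb D$ meets only finitely many kites. *)

(* Defs.v *)
From HB Require Import structures.
From mathcomp Require Import all_boot all_order all_algebra.
From mathcomp Require Import all_classical all_reals all_analysis.
Set Implicit Arguments. Unset Strict Implicit. Unset Printing Implicit Defensive.
Import Order.TTheory GRing.Theory Num.Theory.
Import numFieldNormedType.Exports.
Local Open Scope classical_set_scope.
Local Open Scope ring_scope.

Notation pt R := (R * R)%type.

Section Geometry.
Variable R : realType.


Definition vsub (z w : pt R) : pt R := (z.1 - w.1, z.2 - w.2).
Definition dotp (z w : pt R) : R := z.1 * w.1 + z.2 * w.2.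
Definition detp (z w : pt R) : R := z.1 * w.2 - z.2 * w.1.
Definition enorm (z : pt R) : R := Num.sqrt (dotp z z).
Definition edist (z w : pt R) : R := enorm (vsub z w).

Definition udisc : set (pt R) := [set z | dotp z z < 1].

Definition angle (a o b : pt R) : R :=
  acos (dotp (vsub a o) (vsub b o) / (enorm (vsub a o) * enorm (vsub b o))).

Definition triangle (a b c : pt R) : set (pt R) :=
  [set z | exists s t u : R, [/\ 0 <= s, 0 <= t, 0 <= u, s + t + u = 1 &
       z = (s * a.1 + t * b.1 + u * c.1, s * a.2 + t * b.2 + u * c.2)]].

Definition acosh (x : R) : R := ln (x + Num.sqrt (x ^+ 2 - 1)).
Definition hdist (z w : pt R) : R :=
  acosh (1 + 2 * dotp (vsub z w) (vsub z w) / ((1 - dotp z z) * (1 - dotp w w))).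

Definition hyp_isometry (f : pt R -> pt R) : Prop :=
  [/\ (forall z, udisc z -> udisc (f z)),
      (forall w, udisc w -> exists2 z, udisc z & f z = w) &
      (forall z w, udisc z -> udisc w -> hdist (f z) (f w) = hdist z w)].

End Geometry.
Arguments udisc : clear implicits.

Definition nxt (i : 'I_4) : 'I_4 := inord (i.+1 %% 4).

(* b-quad-graphs, given as cell decompositions of (a domain in) the plane.  *)
(* Each face f is the image of the closed unit square under a continuous    *)
(* injective map qcell f, whose corners (0,0),(1,0),(1,1),(0,1) are the      *)
(* positions of the vertices qfv f 0, qfv f 1, qfv f 2, qfv f 3 (white,     *)
(* black, white, black).  The labelling of the corners of all faces is      *)
(* coherent (induced by one orientation of the plane).                      *)
Record quad_graph (R : realType) := QuadGraph {
  qV : Type;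
  qF : Type;
  qwhite : qV -> bool;
  qpos : qV -> pt R;
  qfv : qF -> 'I_4 -> qV;
  qcell : qF -> pt R -> pt R }.
Arguments qwhite {R} q _.
Arguments qpos {R} q _.
Arguments qfv {R} q _ _.
Arguments qcell {R} q _ _.

Section QuadGraph.
Variable R : realType.
Variable Q : quad_graph R.
Local Notation V := (qV Q).
Local Notation F := (qF Q).
Local Notation fv := (qfv Q).
Local Notation cell := (qcell Q).

Definition csquare : set (pt R) := [set x | 0 <= x.1 <= 1 /\ 0 <= x.2 <= 1].
Definition osquare : set (pt R) := [set x | 0 < x.1 < 1 /\ 0 < x.2 < 1].
Definition corner (i : 'I_4) : pt R :=
  match val i with 0 => (0, 0) | 1 => (1, 0) | 2 => (1, 1) | _ => (0, 1) end.
Definition side (i : 'I_4) : set (pt R) :=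
  [set x | exists2 t : R, 0 <= t <= 1 &
     x = ((1 - t) * (corner i).1 + t * (corner (nxt i)).1,
          (1 - t) * (corner i).2 + t * (corner (nxt i)).2)].

Definition face_set (f : F) : set (pt R) := cell f @` csquare.
Definition face_int (f : F) : set (pt R) := cell f @` osquare.

Definition bquad_graph_of_disc : Prop :=
      (forall f, [/\ qwhite Q (fv f 0), ~~ qwhite Q (fv f 1),
                     qwhite Q (fv f (inord 2)) & ~~ qwhite Q (fv f (inord 3))]) /\
      (forall f, {within csquare, continuous (cell f)} /\
                 {in csquare &, injective (cell f)}) /\
      (forall f i, cell f (corner i) = qpos Q (fv f i)) /\
      (injective (qpos Q) /\ (forall v, exists f i, fv f i = v)) /\
      \bigcup_(f in setT) face_set f = udisc R /\
      (forall f g, f <> g -> face_int f `&` face_int g = set0) /\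
      (forall f g, f <> g ->
         let I := face_set f `&` face_set g in
         [\/ I = set0,
             exists i j, fv f i = fv g j /\ I = [set qpos Q (fv f i)] |
             exists i j, I = cell f @` side i /\ I = cell g @` side j]) /\
      (* coherent orientation of the corner labels: no edge is traversed *)
      (* in the same direction by two distinct faces *)
      (forall f g i j, f <> g -> fv f i = fv g j -> fv f (nxt i) <> fv g (nxt j)) /\
      (forall K, compact K -> K `<=` udisc R ->
         finite_set [set f | (face_set f `&` K) !=set0]).

Definition star_sum (v : V) (g : F -> 'I_4 -> R) (x : R) : Prop :=
  exists n (es : 'I_n -> F) (idx : 'I_n -> 'I_4),
    [/\ injective es, (forall k, fv (es k) (idx k) = v),
        (forall f i, fv f i = v -> exists k, es k = f) &
        \sum_(k < n) g (es k) (idx k) = x].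

(* admissible labelling alpha : F(D) -> (0, pi); every vertex of a cell *)
(* decomposition of the open disc is interior *)
Definition admissible (alpha : F -> R) : Prop :=
  (forall e, 0 < alpha e < pi) /\
  (forall v, ~~ qwhite Q v -> star_sum v (fun e _ => alpha e) (2 * pi)).

(* data of a circle pattern: for white v the circle with centre cen v and  *)
(* radius rad v; for black v the intersection point ipt v                  *)
Record cpattern := CPattern {
  cen : V -> pt R;
  rad : V -> R;
  ipt : V -> pt R }.

Variable C : cpattern.

Definition circle (v : V) : set (pt R) := [set z | edist z (cen C v) = rad C v].
Definition kpt (v : V) : pt R := if qwhite Q v then cen C v else ipt C v.
Definition fpt (e : F) (i : 'I_4) : pt R := kpt (fv e i).

(* closed kite K_e with vertices cen w1, ipt b1, cen w2, ipt b2 (cut along *)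
(* its symmetry diagonal joining the two centres)                          *)
Definition kite (e : F) : set (pt R) :=
  triangle (fpt e 0) (fpt e 1) (fpt e (inord 2)) `|`
  triangle (fpt e 0) (fpt e (inord 3)) (fpt e (inord 2)).

Definition kite_angle (e : F) (i : 'I_4) : R :=
  if qwhite Q (fv e i) then
    angle (fpt e (nxt i)) (fpt e i) (fpt e (nxt (nxt i))) +
    angle (fpt e (nxt (nxt i))) (fpt e i) (fpt e (nxt (nxt (nxt i))))
  else angle (fpt e (nxt (nxt (nxt i)))) (fpt e i) (fpt e (nxt i)).

Definition circle_pattern (alpha : F -> R) : Prop :=
  (forall v, qwhite Q v -> 0 < rad C v) /\
      (forall e i j, qwhite Q (fv e i) -> ~~ qwhite Q (fv e j) ->
                     edist (ipt C (fv e j)) (cen C (fv e i)) = rad C (fv e i)) /\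
      (forall e, ipt C (fv e 1) <> ipt C (fv e (inord 3))) /\
      (* exterior intersection angle = angle between the radii *)
      (forall e, angle (cen C (fv e 0)) (ipt C (fv e 1)) (cen C (fv e (inord 2))) = alpha e
              /\ angle (cen C (fv e 0)) (ipt C (fv e (inord 3))) (cen C (fv e (inord 2))) = alpha e) /\
      (exists2 s : R, s = 1 \/ s = -1 &
         forall e, 0 < s * detp (vsub (fpt e 1) (fpt e 0)) (vsub (fpt e (inord 2)) (fpt e 0))) /\
      (* the kite pattern is locally isomorphic to Q at every (interior) vertex *)
      (forall v, star_sum v kite_angle (2 * pi)).

Definition common_hull (e e' : F) : set (pt R) :=
  [set z | exists lam : 'I_4 -> R,
     [/\ forall i, 0 <= lam i, \sum_(i < 4) lam i = 1,
         forall i, lam i != 0 -> exists j, fv e i = fv e' j &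
         z = (\sum_(i < 4) lam i * (fpt e i).1, \sum_(i < 4) lam i * (fpt e i).2)]].

Definition embedded : Prop :=
  (forall e e', e <> e' -> interior (kite e) `&` interior (kite e') = set0) /\
  (forall e e', e <> e' -> kite e `&` kite e' = common_hull e e').

Definition locally_finite_in_disc : Prop :=
  forall K, compact K -> K `<=` udisc R -> finite_set [set e | (kite e `&` K) !=set0].

Definition contained_in_disc : Prop :=
  forall v, qwhite Q v -> circle v `<=` udisc R.

End QuadGraph.

(* Main.v *)
Require Import Defs.
From HB Require Import structures.
From mathcomp Require Import all_boot all_order all_algebra.
From mathcomp Require Import all_classical all_reals all_analysis.
From mathcomp Require Import ring lra.
(* Imported again because [edist] is also a name of MathComp-Analysis. *)
Require Import Defs.
Set Implicit Arguments. Unset Strict Implicit. Unset Printing Implicit Defensive.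
Import Order.TTheory GRing.Theory Num.Theory.
Import numFieldNormedType.Exports.
Local Open Scope classical_set_scope.
Local Open Scope ring_scope.

(* Let [kappa] be the geodesic curvature of a circle for the Poincare metric: [coth] of
   the hyperbolic radius when the circle lies in the disc, at most 1 when it crosses the
   unit circle.

   Rigidity of the radii.  Scale the first pattern by a factor [l > 1].  By local
   finiteness only finitely many scaled circles still lie in the disc.  In a hyperbolic
   kite with exterior intersection angle [a], half of the angle at the centre of the
   circle [v] has cotangent
     (kappa_w - kappa_v cos a) / (sin a sqrt (kappa_v ^ 2 - 1)),
   also when the neighbouring circle [w] crosses the unit circle, and these half angles
   add up to [pi] around [v].  At a vertex where the ratio of tanh (r / 2) between the
   second pattern and the scaled first one is maximal, a ratio above 1 would make all
   half angles of the second pattern strictly smaller.  Letting [l] tend to 1, and then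
   exchanging the patterns, the two curvature functions agree.

   Gluing.  In the hyperboloid model centres and intersection points become vectors
   whose Lorentz products within a face depend only on the curvatures and [alpha].  The
   linear isometry matching one face of the two patterns therefore matches all faces,
   by propagation across edges. *)

(** * Disjoint arcs of a circle *)

(** On an infinite graph the ratio of the radii need not attain a maximum. Scaling leaves finitely
    many candidates, at the price of neighbours that cross the unit circle; such a circle has no
    hyperbolic radius but still a curvature, which is why everything is expressed by [kappa].

    The patterns prescribe Euclidean angle sums only, and a star is a list of faces without cyclic
    order. The hyperbolic half angle of a kite is its Euclidean half angle plus a difference
    [F p' - F p], where [F] depends only on the point of the circle and [p], [p'] are the two
    intersection points. The angle sum together with the disjointness of the kites forces the arcs
    that the kites cut out of the circle to tile it. Hence the points [p'] are a permutation of the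
    points [p], the corrections cancel, and the hyperbolic half angles add up to [pi] as well. *)

Section Arcs.
Variable R : realType.
Implicit Types (x y b t : R).

Lemma polar x y b : x ^+ 2 + y ^+ 2 = 1 ->
  exists t, [/\ b <= t, t < b + pi *+ 2, x = cos t & y = sin t].
Proof.
move=> xy1.
have key u v : u ^+ 2 + v ^+ 2 = 1 ->
    exists t, [/\ 0 <= t, t < pi *+ 2, u = cos t & v = sin t :> R].
  move=> uv1.
  have u1 : -1 <= u <= 1.
    by rewrite -ler_norml -(@ler_pXn2r _ 2) ?nnegrE// expr1n real_normK ?num_real//; nra.
  have /andP[u1l u1r] := u1.
  have cu : cos (acos u) = u by rewrite acosK// in_itv.
  have su : sin (acos u) = `|v|.
    by rewrite sin_acos// -[X in Num.sqrt X](_ : v ^+ 2 = _) ?sqrtr_sqr//; lra.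
  have a0 := acos_ge0 u1; have api := acos_lepi u1.
  have pi0 := pi_gt0 R.
  case: (ltrP v 0) => v0; last first.
    exists (acos u); split=> //; first by rewrite mulr2n; lra.
    by rewrite su ger0_norm.
  have a0' : 0 < acos u.
    rewrite lt_def a0 andbT; apply/eqP => a00.
    by move: su; rewrite a00 sin0 => /esym/eqP; rewrite normr_eq0; lra.
  exists (- acos u + pi *+ 2); rewrite cosD2pi sinD2pi cosN sinN cu su.
  by rewrite ltr0_norm// opprK; split=> //; rewrite mulr2n; lra.
(* Rotation by [- b] reduces to the window that starts at 0. *)
have [|t [t0 tpi xt yt]] := key (x * cos b + y * sin b) (y * cos b - x * sin b).
  have := cos2Dsin2 b; nra.
exists (t + b); have cb := cos2sin2 b; rewrite cosD sinD -xt -yt.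
by split; [lra|lra|ring: cb|ring: cb].
Qed.

(** Three candidates, of which [u] and [v] exclude at most two. *)
Lemma exists_between_avoiding x y u v : x < y ->
  exists t, [/\ x < t, t < y, t <> u & t <> v].
Proof.
move=> xy.
pose t1 := (x *+ 3 + y) / 4; pose t2 := (x + y) / 2; pose t3 := (x + y *+ 3) / 4.
have [t1l t12] : x < t1 /\ t1 < t2 by rewrite /t1 /t2; split; lra.
have [t23 t3r] : t2 < t3 /\ t3 < y by rewrite /t2 /t3; split; lra.
case: (pselect (t1 = u \/ t1 = v)) => [t1uv|/not_orP[? ?]]; last by exists t1; split=> //; lra.
case: (pselect (t2 = u \/ t2 = v)) => [t2uv|/not_orP[? ?]]; last by exists t2; split=> //; lra.
by exists t3; split=> // [||]; case: t1uv; case: t2uv; lra.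
Qed.

(** Induction on the number of intervals: remove the one with the largest left end [x k]; the others
    then lie in [[a, x k]]. *)
Lemma sum_disjoint_intervals (n : nat) (A : {set 'I_n}) (x l : 'I_n -> R) a b :
  a <= b ->
  (forall k, k \in A -> [/\ a <= x k, x k + l k <= b & 0 < l k]) ->
  (forall k j, k \in A -> j \in A -> k != j ->
     x k + l k <= x j \/ x j + l j <= x k) ->
  \sum_(k in A) l k <= b - a.
Proof.
move: {2}#|A| (erefl #|A|) => m; elim: m A b => [|m IHm] A b.
  by move/cards0_eq=> -> ? _ _; rewrite big_set0 subr_ge0.
move=> cA ab Hin Hdis.
have [k0 k0A] : exists k, k \in A by apply/set0Pn; rewrite -card_gt0 cA.
have [k kA kmax] := @arg_maxP _ _ _ k0 (fun k => k \in A) x k0A.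
rewrite (big_setD1 k)//=.
have [axk xkb lk] := Hin k kA.
have := IHm (A :\ k) (x k); rewrite [#|_|](_ : _ = m); last first.
  by move: cA; rewrite (cardsD1 k) kA => -[].
move=> /(_ erefl axk); suff H : \sum_(i in A :\ k) l i <= x k - a -> l k + \sum_(i in A :\ k) l i <= b - a.
  move=> I; apply: H; apply: I => j.
    rewrite !inE => /andP[jk jA]; have [axj xjb lj] := Hin j jA; split=> //.
    have := kmax j jA; have [] := Hdis j k jA kA jk; rewrite ?leNgt//=; lra.
  move=> i; rewrite !inE => /andP[_ ?] /andP[_ ?]; exact: Hdis.
lra.
Qed.

Section Circle.
Variables (n : nat) (th : 'I_n -> R) (p q : 'I_n -> R * R).
Let dir t : R * R := (cos t, sin t).
Hypothesis th_gt0 : forall k, 0 < th k.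
Hypothesis th_lt : forall k, th k < pi *+ 2.
Hypothesis sum_th : \sum_(k < n) th k = pi *+ 2.
Hypothesis p_unit : forall k, (p k).1 ^+ 2 + (p k).2 ^+ 2 = 1.
Hypothesis pq : forall k t, p k = dir t -> q k = dir (t + th k).
(** The condition ranges over all arguments of the starting points, that is, over all lifts of the
    arcs to the real line. *)
Hypothesis arcs_disjoint : forall j k t u, j != k -> p j = dir t -> p k = dir u ->
  t + th j <= u \/ u + th k <= t.

Lemma dirD2pi t : dir (t + pi *+ 2) = dir t.
Proof. by rewrite /dir cosD2pi sinD2pi. Qed.

Lemma exists_arg b k : exists t, [/\ b <= t, t < b + pi *+ 2 & p k = dir t].
Proof.
have [t [bt tb ct st]] := polar b (p_unit k).
by exists t; split=> //; rewrite [p k]surjective_pairing ct st.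
Qed.

(** Cut the circle at the end point of the arc [k], of argument [b]. If no arc started there, all
    arcs would lift into [[b, b + 2 pi]] and leave a gap after [b], so their lengths could not add
    up to [2 pi]. *)
Lemma arcs_successor k : exists j, p j = q k.
Proof.
have [t0 [_ _ pk]] := exists_arg 0 k.
have qk := pq pk; set b := t0 + th k in qk.
apply: contrapT => /forallNP np.
have /choice[f Hf] : forall j, exists t, [/\ b < t, t + th j <= b + pi *+ 2 & p j = dir t].
  (* The arc [k] itself is lifted so that it ends at [b + pi *+ 2]; any arc passing beyond that
     point would overlap it. *)
  have pk' : p k = dir (b - th k + pi *+ 2) by rewrite dirD2pi pk /b addrK.
  have tk := th_gt0 k; have tk2 := th_lt k.
  move=> j; have [->|jk] := eqVneq j k.
    by exists (b - th k + pi *+ 2); split=> //; lra.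
  have [t [bt tb pj]] := exists_arg b j; exists t; split=> //.
    by rewrite lt_def bt andbT; apply/eqP => tb'; apply: (np j); rewrite qk pj tb'.
  by have [] := arcs_disjoint jk pj pk'; lra.
have [m _ fmin] := @arg_minP _ _ _ k xpredT f isT.
have [bm mb _] := Hf m; have tm := th_gt0 m.
have := @sum_disjoint_intervals n (finset.setTfor 'I_n) f th (f m) (b + pi *+ 2).
rewrite (eq_bigl xpredT) => [|i]; last by rewrite inE.
rewrite sum_th => H; have : pi *+ 2 <= b + pi *+ 2 - f m; last lra.
apply: H => [|i _|i j _ _ ij]; first lra.
  by have [? ? _] := Hf i; split=> //; exact: fmin.
by have [_ _ pi'] := Hf i; have [_ _ pj'] := Hf j; exact: arcs_disjoint pi' pj'.
Qed.

(** Two arcs with the same end point overlap just before it. The successor map is therefore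
    injective, hence a permutation. *)
Lemma arcs_sum (F : R * R -> R) : \sum_(k < n) F (q k) = \sum_(k < n) F (p k).
Proof.
have /choice[s Hs] := arcs_successor.
have s_inj : injective s.
  move=> j k sjk; apply: contrapT => /eqP jk.
  have [t [_ _ pj]] := exists_arg 0 j.
  have [u0 [_ _ pk0]] := exists_arg 0 k.
  have qjk : q j = q k by rewrite -!Hs sjk.
  have pk : p k = dir (t + th j - th k).
    have := pq pj; rewrite qjk (pq pk0) => -[ec es].
    rewrite pk0 -[u0](addrK (th k)) /dir !(cosB, sinB) ec es //.
  have tj := th_gt0 j; have tk := th_gt0 k.
  by have [] := arcs_disjoint jk pj pk; lra.
under eq_bigr do rewrite -Hs.
by rewrite [RHS](reindex_inj s_inj).
Qed.
End Circle.

End Arcs.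

(** * Kites *)

Section Plane.
Variable R : realType.
Implicit Types (z w a o b p : pt R).

Lemma dotp_ge0 z : 0 <= dotp z z.
Proof. by rewrite /dotp addr_ge0// -expr2 sqr_ge0. Qed.

Lemma enorm_sqr z : enorm z ^+ 2 = dotp z z.
Proof. by rewrite /enorm sqr_sqrtr// dotp_ge0. Qed.

Lemma enorm_ge0 z : 0 <= enorm z.
Proof. exact: sqrtr_ge0. Qed.

Lemma edist_sqr z w : edist z w ^+ 2 = (z.1 - w.1) ^+ 2 + (z.2 - w.2) ^+ 2.
Proof. by rewrite /edist enorm_sqr /dotp /vsub /= -!expr2. Qed.

Lemma edistC z w : edist z w = edist w z.
Proof.
by apply/eqP; rewrite -(@eqrXn2 _ 2)// ?enorm_ge0// !edist_sqr; apply/eqP; ring.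
Qed.

Lemma edist_gt0 z w : z <> w -> 0 < edist z w.
Proof.
move=> zw; rewrite lt_def enorm_ge0 andbT; apply/eqP => zw0; apply: zw.
have := edist_sqr z w; rewrite zw0 expr0n => /esym/eqP.
rewrite paddr_eq0 ?sqr_ge0// !sqrf_eq0 !subr_eq0 => /andP[/eqP z1 /eqP z2].
by rewrite [z]surjective_pairing [w]surjective_pairing z1 z2.
Qed.

Lemma angleC a o b : angle a o b = angle b o a.
Proof. by rewrite /angle [enorm _ * _]mulrC [dotp _ _](_ : _ = dotp (vsub b o) (vsub a o)) // /dotp; ring. Qed.

Lemma angle_polar a o b : 0 < edist a o -> 0 < edist b o ->
  [/\ 0 <= angle a o b, angle a o b <= pi,
      edist a o * edist b o * cos (angle a o b) = dotp (vsub a o) (vsub b o) &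
      edist a o * edist b o * sin (angle a o b) = `|detp (vsub a o) (vsub b o)|].
Proof.
rewrite /angle -/(edist a o) -/(edist b o) => a0 b0.
set u := vsub a o; set v := vsub b o; set m := edist a o * edist b o.
have m0 : 0 < m by rewrite mulr_gt0.
have lagrange : dotp u v ^+ 2 + detp u v ^+ 2 = m ^+ 2.
  by rewrite exprMn /edist !enorm_sqr -/u -/v /dotp /detp; ring.
set x := dotp u v / m.
have xm : m * x = dotp u v by rewrite /x mulrC divfK// gt_eqF.
have x1 : -1 <= x <= 1.
  rewrite -ler_norml -(@ler_pXn2r _ 2) ?nnegrE// expr1n real_normK ?num_real//.
  rewrite /x expr_div_n ler_pdivrMr ?exprn_gt0// mul1r -lagrange.
  by rewrite lerDl sqr_ge0.
have cx : cos (acos x) = x by rewrite acosK// in_itv.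
split; [exact: acos_ge0|exact: acos_lepi|by rewrite cx|].
rewrite sin_acos//; apply/eqP; rewrite -(@eqrXn2 _ 2)//; last first.
  by rewrite mulr_ge0 ?sqrtr_ge0 ?ltW.
have [? ?] := andP x1.
rewrite exprMn sqr_sqrtr; last nra.
rewrite real_normK ?num_real// mulrBr -exprMn xm mulr1 -lagrange.
by apply/eqP; ring.
Qed.

Lemma kite_mirror (O p w p' : pt R) : w <> O -> edist p O = edist p' O ->
  edist p w = edist p' w -> p <> p' ->
  dotp (vsub p' O) (vsub w O) = dotp (vsub p O) (vsub w O) /\
  detp (vsub p' O) (vsub w O) = - detp (vsub p O) (vsub w O).
Proof.
move=> /edist_gt0 d0 pO pw pp'; set d := edist w O in d0.
have pO2 := edist_sqr p O; have p'O2 := edist_sqr p' O.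
have pw2 := edist_sqr p w; have p'w2 := edist_sqr p' w.
have wO2 := edist_sqr w O; rewrite -/d in wO2.
rewrite pO in pO2; rewrite pw in pw2.
have dotE : dotp (vsub p' O) (vsub w O) = dotp (vsub p O) (vsub w O).
  by move: pO2 p'O2 pw2 p'w2; rewrite /dotp /vsub /=; lra.
have detE : detp (vsub p' O) (vsub w O) = - detp (vsub p O) (vsub w O).
  have : detp (vsub p' O) (vsub w O) ^+ 2 = detp (vsub p O) (vsub w O) ^+ 2.
    have L q : detp (vsub q O) (vsub w O) ^+ 2 =
        ((q.1 - O.1) ^+ 2 + (q.2 - O.2) ^+ 2) * d ^+ 2 - dotp (vsub q O) (vsub w O) ^+ 2.
      by rewrite wO2 /dotp /detp /vsub /=; ring.
    by rewrite !L dotE -p'O2 -pO2.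
  move/eqP; rewrite eqf_sqr => /orP[/eqP detE|/eqP//]; case: pp'.
  have d2 : d ^+ 2 != 0 by rewrite expf_neq0// gt_eqF.
  have x_of q : d ^+ 2 * (q.1 - O.1) = (w.1 - O.1) * dotp (vsub q O) (vsub w O)
      + (w.2 - O.2) * detp (vsub q O) (vsub w O).
    by rewrite wO2 /dotp /detp /vsub /=; ring.
  have y_of q : d ^+ 2 * (q.2 - O.2) = (w.2 - O.2) * dotp (vsub q O) (vsub w O)
      - (w.1 - O.1) * detp (vsub q O) (vsub w O).
    by rewrite wO2 /dotp /detp /vsub /=; ring.
  have e1 : d ^+ 2 * (p.1 - O.1) = d ^+ 2 * (p'.1 - O.1) by rewrite !x_of dotE detE.
  have e2 : d ^+ 2 * (p.2 - O.2) = d ^+ 2 * (p'.2 - O.2) by rewrite !y_of dotE detE.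
  move/(mulfI d2): e1 => e1; move/(mulfI d2): e2 => e2.
  by rewrite [p]surjective_pairing [p']surjective_pairing; congr (_, _); lra.
by [].
Qed.

(** The factor [s] reflects a negatively oriented pattern, so that arguments seen from [O] always
    increase from [p] over [w] to [p']. The values of [d * cos th] and [d * sin th] come from the
    law of cosines in the triangle [O p w], whose angle at [p] is [a]. *)
Lemma kite_corner (O p w p' : pt R) (r rw a s : R) :
  0 < r -> 0 < rw -> 0 < a < pi -> s = 1 \/ s = -1 ->
  edist p O = r -> edist p' O = r -> edist p w = rw -> edist p' w = rw ->
  p <> p' -> angle O p w = a -> 0 < s * detp (vsub p O) (vsub w O) ->
  let th := angle p O w in let d := edist w O in
  [/\ angle w O p' = th, 0 < th < pi, 0 < d,
      d * cos th = r - rw * cos a /\ d * sin th = rw * sin a &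
      forall t, vsub p O = (r * cos t, r * (s * sin t)) ->
        vsub w O = (d * cos (t + th), d * (s * sin (t + th))) /\
        vsub p' O = (r * cos (t + th *+ 2), r * (s * sin (t + th *+ 2)))].
Proof.
move=> r0 rw0 a0 s1 pO p'O pw p'w pp' aE sdet th d.
have d0 : 0 < d.
  by apply: edist_gt0 => wO; move: sdet; rewrite wO /detp /vsub /= !subrr; lra.
have s2 : s ^+ 2 = 1 by case: s1 => ->; ring.
have := @angle_polar p O w; rewrite pO -/th -/d => /(_ r0 d0)[th0 thpi E1 E2].
have {E2} E2 : s * (r * d * sin th) = detp (vsub p O) (vsub w O).
  rewrite E2; case: (ger0P (detp (vsub p O) (vsub w O))) => D0; case: s1 sdet => ->; lra.
have sth : 0 < sin th.
  by move: sdet; rewrite -E2 mulrA -expr2 s2 mul1r pmulr_rgt0// mulr_gt0.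
have th0' : 0 < th by rewrite lt_def th0 andbT; apply/eqP => t0; move: sth; rewrite t0 sin0; lra.
have thpi' : th < pi.
  by rewrite lt_def thpi andbT; apply/eqP => t0; move: sth; rewrite -t0 sinpi; lra.
have pO2 := edist_sqr p O; have p'O2 := edist_sqr p' O.
have pw2 := edist_sqr p w; have p'w2 := edist_sqr p' w.
have wO2 := edist_sqr w O; rewrite -/d in wO2.
rewrite pO in pO2; rewrite p'O in p'O2; rewrite pw in pw2; rewrite p'w in p'w2.
have := @angle_polar O p w.
rewrite [edist O p]edistC pO [edist w p]edistC pw aE => /(_ r0 rw0)[a_ge0 a_lepi A1 A2].
have sa : 0 < sin a by exact: sin_gt0_pi.
have dth : d * cos th = r - rw * cos a.
  apply: (@mulfI _ r); rewrite ?gt_eqF//.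
  rewrite mulrA E1 mulrBr mulrA A1 -expr2 pO2 /dotp /vsub /=; ring.
have dst : d * sin th = rw * sin a.
  apply/eqP; rewrite -(@eqrXn2 _ 2) ?mulr_ge0 ?ltW//.
  have ct := cos2sin2 th; have ca := cos2sin2 a.
  have dd : d ^+ 2 = r ^+ 2 + rw ^+ 2 - 2 * r * rw * cos a.
    rewrite wO2 -[2 * r * rw]mulrA -mulrA A1 pO2 pw2 /dotp /vsub /=; ring.
  apply/eqP; have -> : (d * sin th) ^+ 2 = d ^+ 2 - (d * cos th) ^+ 2 by ring: ct.
  by rewrite dth dd; ring: ca.
have [dotE detE] : dotp (vsub p' O) (vsub w O) = dotp (vsub p O) (vsub w O) /\
    detp (vsub p' O) (vsub w O) = - detp (vsub p O) (vsub w O).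
  apply: kite_mirror => //; [|by rewrite pO|by rewrite pw].
  by move=> wO; move: d0; rewrite /d wO /edist /vsub !subrr /enorm /dotp /= mulr0 addr0 sqrtr0 ltxx.
have th2 : angle w O p' = th.
  rewrite angleC /th /angle -/(edist p' O) -/(edist p O) -/(edist w O) dotE.
  by rewrite pO p'O.
split=> //; first by rewrite th0'.
move=> t pt; have ctt := cos2sin2 t; have ctth := cos2sin2 th.
have w1 : vsub w O = (d * cos (t + th), d * (s * sin (t + th))).
  move: E1 E2; rewrite pt; move: (vsub w O) => u; rewrite /dotp /detp /= => E1 E2.
  have r00 : r != 0 by rewrite gt_eqF.
  have {}E1 : d * cos th = cos t * u.1 + s * sin t * u.2.
    by apply: (mulfI r00); rewrite mulrA E1; ring.
  have {}E2 : s * (d * sin th) = cos t * u.2 - s * sin t * u.1.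
    by apply: (mulfI r00); transitivity (s * (r * d * sin th)); [ring|rewrite E2; ring].
  have u1 : d * cos (t + th) = u.1.
    rewrite cosD; transitivity (cos t * (d * cos th) - s ^+ 2 * sin t * (d * sin th)); first by rewrite s2; ring.
    transitivity (cos t * (d * cos th) - s * sin t * (s * (d * sin th))); first by ring.
    by rewrite E1 E2; ring: ctt s2.
  have u2 : d * (s * sin (t + th)) = u.2.
    rewrite sinD; transitivity (s * sin t * (d * cos th) + cos t * (s * (d * sin th))); first by ring.
    by rewrite E1 E2; ring: ctt s2.
  by rewrite u1 u2 -surjective_pairing.
split=> //.
(* In the frame of the axis direction [v], the vector from [O] to [p'] is recovered from its scalar
   product and determinant with [w - O]. *)
move: dotE detE E1 E2; rewrite pt w1; move: (vsub p' O) => u; set v := t + th.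
have -> : t + th *+ 2 = v + th by rewrite /v; ring.
have -> : t = v - th by rewrite /v; ring.
have ctv := cos2sin2 v.
rewrite cosB sinB cosD sinD /dotp /detp /= => dotE detE _ _.
have d00 : d != 0 by rewrite gt_eqF.
have {}dotE : u.1 * cos v + u.2 * (s * sin v) = r * cos th.
  apply: (mulfI d00).
  transitivity (u.1 * (d * cos v) + u.2 * (d * (s * sin v))); first by ring.
  by rewrite dotE; ring: ctv s2.
have {}detE : u.1 * (s * sin v) - u.2 * cos v = - s * (r * sin th).
  apply: (mulfI d00).
  transitivity (u.1 * (d * (s * sin v)) - u.2 * (d * cos v)); first by ring.
  by rewrite detE; ring: ctv s2.
rewrite [LHS]surjective_pairing; congr (_, _).
  transitivity (cos v * (u.1 * cos v + u.2 * (s * sin v)) + s * sin v * (u.1 * (s * sin v) - u.2 * cos v)).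
    by ring: ctv s2.
  by rewrite dotE detE; ring: s2.
transitivity (s * sin v * (u.1 * cos v + u.2 * (s * sin v)) - cos v * (u.1 * (s * sin v) - u.2 * cos v)).
  by ring: ctv s2.
by rewrite dotE detE; ring: s2.
Qed.
End Plane.

(** * Triangles near one of their vertices *)

Section Sectors.
Variable R : realType.
Implicit Types (z w a b c o p : pt R).

Lemma triangleAC a b c : triangle a b c = triangle a c b.
Proof.
suff H x y z : triangle x y z `<=` triangle x z y by apply/seteqP; split; exact: H.
move=> _ [s [t [u [s0 t0 u0 stu ->]]]]; exists s, u, t; split=> //; first lra.
by congr (_, _); ring.
Qed.

Lemma triangle_rev a b c : triangle a b c = triangle c b a.
Proof.
suff H x y z : triangle x y z `<=` triangle z y x by apply/seteqP; split; exact: H.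
move=> _ [s [t [u [s0 t0 u0 stu ->]]]]; exists u, t, s; split=> //; first lra.
by congr (_, _); ring.
Qed.

Lemma near_affine_gt0 (k l m : R) z : 0 < k + l * z.1 + m * z.2 ->
  \forall x \near z, 0 < k + l * x.1 + m * x.2.
Proof.
move=> z0.
have : (fun x : pt R => k + l * x.1 + m * x.2) y @[y --> z] --> k + l * z.1 + m * z.2.
  apply: cvgD; first (apply: cvgD; first by apply: cvg_cst).
    apply: cvgM; first by apply: cvg_cst.
    by apply: cvg_fst.
  apply: cvgM; first by apply: cvg_cst.
  by apply: cvg_snd.
by move=> /(_ _ (lt_nbhsr z0)).
Qed.

(** By Cramer's rule the barycentric coordinates [T], [U] and [1 - T - U] are affine functions of
    the point, so they stay positive nearby. *)
Lemma triangle_nbhs a b c (s t u : R) : 0 < s -> 0 < t -> 0 < u -> s + t + u = 1 ->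
  detp (vsub b a) (vsub c a) != 0 ->
  nbhs (s * a.1 + t * b.1 + u * c.1, s * a.2 + t * b.2 + u * c.2) (triangle a b c).
Proof.
move=> s0 t0 u0 stu; set D := detp _ _ => D0; set z := (_, _).
pose T x := detp (vsub x a) (vsub c a) / D; pose U x := detp (vsub b a) (vsub x a) / D.
have Tz : T z = t.
  apply: (mulIf D0); rewrite divfK// /D /detp /vsub /z /=.
  have -> : s = 1 - t - u by lra.
  by ring.
have Uz : U z = u.
  apply: (mulIf D0); rewrite divfK// /D /detp /vsub /z /=.
  have -> : s = 1 - t - u by lra.
  by ring.
have T_gt0 : \forall x \near z, 0 < T x.
  have TE x : T x = (- a.1 * (c.2 - a.2) + a.2 * (c.1 - a.1)) / D
     + (c.2 - a.2) / D * x.1 + - (c.1 - a.1) / D * x.2.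
    by rewrite /T /detp /vsub /=; ring.
  have := @near_affine_gt0 ((- a.1 * (c.2 - a.2) + a.2 * (c.1 - a.1)) / D)
    ((c.2 - a.2) / D) (- (c.1 - a.1) / D) z.
  by rewrite -TE Tz => /(_ t0); apply: filterS => x; rewrite TE.
have U_gt0 : \forall x \near z, 0 < U x.
  have UE x : U x = (- a.2 * (b.1 - a.1) + a.1 * (b.2 - a.2)) / D
     + - (b.2 - a.2) / D * x.1 + (b.1 - a.1) / D * x.2.
    by rewrite /U /detp /vsub /=; ring.
  have := @near_affine_gt0 ((- a.2 * (b.1 - a.1) + a.1 * (b.2 - a.2)) / D)
    (- (b.2 - a.2) / D) ((b.1 - a.1) / D) z.
  by rewrite -UE Uz => /(_ u0); apply: filterS => x; rewrite UE.
have S_gt0 : \forall x \near z, 0 < 1 - T x - U x.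
  pose k := 1 + (- (- a.1 * (c.2 - a.2) + a.2 * (c.1 - a.1)) - (- a.2 * (b.1 - a.1) + a.1 * (b.2 - a.2))) / D.
  have SE x : 1 - T x - U x = k
     + (- (c.2 - a.2) + (b.2 - a.2)) / D * x.1 + ((c.1 - a.1) - (b.1 - a.1)) / D * x.2.
    by rewrite /T /U /k /detp /vsub /=; ring.
  have := @near_affine_gt0 k ((- (c.2 - a.2) + (b.2 - a.2)) / D)
    (((c.1 - a.1) - (b.1 - a.1)) / D) z.
  rewrite -SE Tz Uz => H; have {}H := H ltac:(lra).
  by apply: filterS H => x; rewrite SE.
near=> x; exists (1 - T x - U x), (T x), (U x).
have Tx : 0 < T x by near: x.
have Ux : 0 < U x by near: x.
have Sx : 0 < 1 - T x - U x by near: x.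
split; [exact: ltW|exact: ltW|exact: ltW|ring|].
have Tm : D * T x = detp (vsub x a) (vsub c a) by rewrite mulrC divfK.
have Um : D * U x = detp (vsub b a) (vsub x a) by rewrite mulrC divfK.
have E1 : D * (T x * (b.1 - a.1) + U x * (c.1 - a.1)) = D * (x.1 - a.1).
  transitivity ((D * T x) * (b.1 - a.1) + (D * U x) * (c.1 - a.1)); first by ring.
  by rewrite Tm Um /D /detp /vsub /=; ring.
have E2 : D * (T x * (b.2 - a.2) + U x * (c.2 - a.2)) = D * (x.2 - a.2).
  transitivity ((D * T x) * (b.2 - a.2) + (D * U x) * (c.2 - a.2)); first by ring.
  by rewrite Tm Um /D /detp /vsub /=; ring.
move/(mulfI D0): E1; move/(mulfI D0): E2 => E2 E1.
by rewrite [LHS]surjective_pairing; congr (_, _); lra.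
Unshelve. all: by end_near.
Qed.

Definition ray (s : R) o (t l : R) : pt R := (o.1 + l * cos t, o.2 + l * (s * sin t)).

Lemma sector_interior (s r d t th v : R) o : s = 1 \/ s = -1 -> 0 < r -> 0 < d ->
  0 < th < pi -> t < v -> v < t + th ->
  exists2 l0 : R, 0 < l0 & forall l, 0 < l -> l < l0 ->
    nbhs (ray s o v l) (triangle o (ray s o t r) (ray s o (t + th) d)).
Proof.
move=> s1 r0 d0 /andP[th0 thpi] tv vt.
have s2 : s ^+ 2 = 1 by case: s1 => ->; ring.
have sth : 0 < sin th by apply: sin_gt0_pi; lra.
have [u vE] : exists u, v = t + u by exists (v - t); ring.
have su : 0 < sin u by apply: sin_gt0_pi; lra.
have stu : 0 < sin (th - u) by apply: sin_gt0_pi; lra.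
have rs : 0 < r * sin th by rewrite mulr_gt0.
have ds : 0 < d * sin th by rewrite mulr_gt0.
pose k := sin (th - u) / (r * sin th) + sin u / (d * sin th).
have k0 : 0 < k by rewrite addr_gt0 ?divr_gt0.
(* By the sine rule the weights [y] and [x] of the two outer vertices add up to [l * k]; the ray
   leaves the triangle at distance [k^-1]. *)
exists k^-1 => [|l l0 lk]; first by rewrite invr_gt0.
have kl : l * k < 1 by rewrite -ltr_pdivlMr// mul1r.
set y := l * sin (th - u) / (r * sin th); set x := l * sin u / (d * sin th).
have ctt := cos2sin2 t; have ctth := cos2sin2 th; have ctu := cos2sin2 u.
have -> : ray s o v l =
    ((1 - y - x) * o.1 + y * (ray s o t r).1 + x * (ray s o (t + th) d).1,
     (1 - y - x) * o.2 + y * (ray s o t r).2 + x * (ray s o (t + th) d).2).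
  have yr : y * r = l * sin (th - u) / sin th by rewrite /y; field; rewrite ?gt_eqF.
  have xd : x * d = l * sin u / sin th by rewrite /x; field; rewrite ?gt_eqF.
  rewrite /ray /=; congr (_, _).
    transitivity (o.1 + (y * r) * cos t + (x * d) * cos (t + th)); last by ring.
    rewrite yr xd vE !cosD sinB.
    by field; rewrite ?gt_eqF.
  transitivity (o.2 + (y * r) * (s * sin t) + (x * d) * (s * sin (t + th))); last by ring.
  rewrite yr xd vE sinB !sinD.
  by field; rewrite ?gt_eqF.
have y0 : 0 < y by rewrite divr_gt0 ?mulr_gt0.
have x0 : 0 < x by rewrite divr_gt0 ?mulr_gt0.
apply: triangle_nbhs => //; [|ring|].
  suff : y + x < 1 by lra.
  by rewrite /y /x -!mulrA -mulrDr.
rewrite (_ : detp _ _ = s * (r * (d * sin th))); last first.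
  by rewrite /detp /vsub /ray /= cosD sinD; ring: ctt.
by rewrite mulf_neq0 ?(gt_eqF (mulr_gt0 r0 ds))// -sqrf_eq0 s2 oner_eq0.
Qed.
End Sectors.

(** * Corners of kites at white vertices *)

Lemma nxt0 : nxt 0 = 1.
Proof. by apply/val_inj; rewrite /= inordK. Qed.

Lemma nxt1 : nxt 1 = inord 2.
Proof. by apply/val_inj; rewrite /= !inordK. Qed.

Lemma nxt2 : nxt (inord 2) = inord 3.
Proof. by apply/val_inj; rewrite /= !inordK. Qed.

Lemma nxt3 : nxt (inord 3) = 0.
Proof. by apply/val_inj; rewrite /= !inordK. Qed.

Definition nxtE := (nxt0, nxt1, nxt2, nxt3).

Lemma ord4P (P : 'I_4 -> Prop) : P 0 -> P 1 -> P (inord 2) -> P (inord 3) ->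
  forall i, P i.
Proof.
move=> P0 P1 P2 P3 [[|[|[|[|//]]]] i4].
- by rewrite (_ : Ordinal i4 = 0)//; exact/val_inj.
- by rewrite (_ : Ordinal i4 = 1)//; exact/val_inj.
- by rewrite (_ : Ordinal i4 = inord 2)//; apply/val_inj; rewrite /= inordK.
- by rewrite (_ : Ordinal i4 = inord 3)//; apply/val_inj; rewrite /= inordK.
Qed.

Section Corners.
Variables (R : realType) (Q : quad_graph R) (alpha : qF Q -> R) (C : cpattern Q).
Hypothesis colors : forall f, [/\ qwhite Q (qfv Q f 0), ~~ qwhite Q (qfv Q f 1),
  qwhite Q (qfv Q f (inord 2)) & ~~ qwhite Q (qfv Q f (inord 3))].
Hypothesis alpha_bounds : forall e, 0 < alpha e < pi.
Hypothesis pattern : circle_pattern C alpha.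

Local Notation fv := (qfv Q).
Local Notation white := (qwhite Q).

Lemma white_nxt e i : white (fv e (nxt i)) = ~~ white (fv e i).
Proof.
have [c0 c1 c2 c3] := colors e.
by move: i; apply: ord4P; rewrite nxtE ?(negPf c1) ?(negPf c3) ?c0 ?c2.
Qed.

Lemma rad_gt0 v : white v -> 0 < rad C v.
Proof. by case: pattern => H _; exact: H. Qed.

Lemma ipt_edist e i j : white (fv e i) -> ~~ white (fv e j) ->
  edist (ipt C (fv e j)) (cen C (fv e i)) = rad C (fv e i).
Proof. by case: pattern => _ [H _]; exact: H. Qed.

Lemma pattern_orientation : exists2 s : R, s = 1 \/ s = -1 & forall e,
  0 < s * detp (vsub (ipt C (fv e 1)) (cen C (fv e 0)))
               (vsub (cen C (fv e (inord 2))) (cen C (fv e 0))).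
Proof.
case: pattern => _ [_ [_ [_ [[s s1 H] _]]]]; exists s => // e.
have [c0 c1 c2 c3] := colors e.
by have := H e; rewrite /fpt /kpt c0 (negPf c1) c2.
Qed.

Section Oriented.
Variable s : R.
Hypothesis s1 : s = 1 \/ s = -1.
Hypothesis orient : forall e,
  0 < s * detp (vsub (ipt C (fv e 1)) (cen C (fv e 0)))
               (vsub (cen C (fv e (inord 2))) (cen C (fv e 0))).

Section Corner.
(** The white corners 0 and 2 of a face are treated alike: [p], [w], [p'] follow the centre [O] in
    the cyclic order of the face. *)
Variables (e : qF Q) (i : 'I_4).
Hypothesis wi : white (fv e i).
Let O := cen C (fv e i).
Let p := ipt C (fv e (nxt i)).
Let w := cen C (fv e (nxt (nxt i))).
Let p' := ipt C (fv e (nxt (nxt (nxt i)))).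

Lemma corner_edist : [/\ edist p O = rad C (fv e i), edist p' O = rad C (fv e i),
  edist p w = rad C (fv e (nxt (nxt i))) & edist p' w = rad C (fv e (nxt (nxt i)))].
Proof. by split; apply: ipt_edist; rewrite ?white_nxt ?negbK ?wi. Qed.

Lemma corner_neq : p <> p'.
Proof.
case: pattern => _ [_ [H _]]; have H' := H e; rewrite /p /p'.
have [c0 c1 c2 c3] := colors e.
move: wi; move: (i); apply: ord4P => //; rewrite ?(negPf c1) ?(negPf c3) ?nxtE// => _ /esym.
exact: H'.
Qed.

Lemma corner_angle : angle O p w = alpha e.
Proof.
case: pattern => _ [_ [_ [H _]]]; have [H1 H3] := H e; rewrite /O /p /w.
have [c0 c1 c2 c3] := colors e.
move: wi; move: (i); apply: ord4P; rewrite ?(negPf c1) ?(negPf c3) ?nxtE// => _.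
by rewrite angleC.
Qed.

(** The pattern gives the sign at corner 0 only. At the opposite white corner both the reflected
    intersection point and the reversed axis change the sign, which leaves it the same. *)
Lemma corner_orient : 0 < s * detp (vsub p O) (vsub w O).
Proof.
have [pO p'O pw p'w] := corner_edist; have pp' := corner_neq.
have o := orient e; rewrite /O /p /w.
have [c0 c1 c2 c3] := colors e.
move: wi pO p'O pw p'w pp'; rewrite /O /p /w /p'; move: (i).
apply: ord4P; rewrite ?(negPf c1) ?(negPf c3) ?nxtE// => _ pO p'O pw p'w pp'.
have [] := @kite_mirror _ (cen C (fv e 0)) (ipt C (fv e 1)) (cen C (fv e (inord 2))) (ipt C (fv e (inord 3))).
- by move=> E; move: o; rewrite E /detp /vsub !subrr /= !mulr0 subr0 mulr0 ltxx.
- by rewrite p'w pw.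
- by rewrite p'O pO.
- by move/esym.
move=> _ E; move: o; have -> : detp (vsub (ipt C (fv e 1)) (cen C (fv e 0)))
       (vsub (cen C (fv e (inord 2))) (cen C (fv e 0))) =
   - detp (vsub (ipt C (fv e (inord 3))) (cen C (fv e 0)))
      (vsub (cen C (fv e (inord 2))) (cen C (fv e 0))) by rewrite E opprK.
by congr (0 < s * _); rewrite /detp /vsub /=; ring.
Qed.

Lemma corner_kite : triangle O p w `<=` kite C e /\ triangle O w p' `<=` kite C e.
Proof.
rewrite /kite /fpt /kpt /O /p /w /p'.
have [c0 c1 c2 c3] := colors e.
move: wi; move: (i); apply: ord4P; rewrite ?(negPf c1) ?(negPf c3) ?nxtE// => _;
  rewrite c0 c2; split=> z zT; [by left|by right; rewrite triangleAC|right|left].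
  by rewrite triangle_rev.
by rewrite triangle_rev triangleAC triangle_rev triangleAC triangle_rev in zT *.
Qed.

Definition half_angle := angle p O w.

Lemma corner_polar : let d := edist w O in
  [/\ kite_angle C e i = half_angle *+ 2, 0 < half_angle < pi, 0 < d,
      d * cos half_angle = rad C (fv e i) - rad C (fv e (nxt (nxt i))) * cos (alpha e) /\
      d * sin half_angle = rad C (fv e (nxt (nxt i))) * sin (alpha e) &
      forall t, vsub p O = (rad C (fv e i) * cos t, rad C (fv e i) * (s * sin t)) ->
        vsub w O = (d * cos (t + half_angle), d * (s * sin (t + half_angle))) /\
        vsub p' O = (rad C (fv e i) * cos (t + half_angle *+ 2),
                     rad C (fv e i) * (s * sin (t + half_angle *+ 2)))].
Proof.
have [pO p'O pw p'w] := corner_edist.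
have rw0 : 0 < rad C (fv e (nxt (nxt i))) by apply: rad_gt0; rewrite !white_nxt negbK.
have [th2 th0 d0 dth polarE] := kite_corner (rad_gt0 wi) rw0 (alpha_bounds e) s1 pO p'O pw p'w
  corner_neq corner_angle corner_orient.
split=> //; rewrite /kite_angle wi /fpt /kpt !white_nxt wi /=.
by rewrite -/O -/p -/w -/p' th2 mulr2n.
Qed.
End Corner.
End Oriented.
End Corners.

(** * The kites around a white vertex *)

Section Star.
Variables (R : realType) (Q : quad_graph R) (alpha : qF Q -> R) (C : cpattern Q).
Hypothesis colors : forall f, [/\ qwhite Q (qfv Q f 0), ~~ qwhite Q (qfv Q f 1),
  qwhite Q (qfv Q f (inord 2)) & ~~ qwhite Q (qfv Q f (inord 3))].
Hypothesis alpha_bounds : forall e, 0 < alpha e < pi.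
Hypothesis pattern : circle_pattern C alpha.
Hypothesis kites_disjoint : forall e e', e <> e' ->
  interior (kite C e) `&` interior (kite C e') = set0.
Local Notation fv := (qfv Q).
Variable s : R.
Hypothesis s1 : s = 1 \/ s = -1.
Hypothesis orient : forall e,
  0 < s * detp (vsub (ipt C (fv e 1)) (cen C (fv e 0)))
               (vsub (cen C (fv e (inord 2))) (cen C (fv e 0))).

(** The diagonal direction is left out because the two triangles that make up the kite are treated
    separately. *)
Lemma kite_sector e i t x : qwhite Q (fv e i) ->
  vsub (ipt C (fv e (nxt i))) (cen C (fv e i)) =
    (rad C (fv e i) * cos t, rad C (fv e i) * (s * sin t)) ->
  t < x -> x < t + half_angle C e i *+ 2 -> x <> t + half_angle C e i ->
  exists2 l0 : R, 0 < l0 & forall l, 0 < l -> l < l0 ->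
    interior (kite C e) (ray s (cen C (fv e i)) x l).
Proof.
move=> wi pt tx xt xneq.
have [_ th0 d0 _ /(_ t pt)[wt p't]] := corner_polar colors alpha_bounds pattern s1 orient wi.
have [k1 k2] := corner_kite C colors wi.
have r0 := rad_gt0 pattern wi.
set O := cen C (fv e i) in pt wt p't d0 k1 k2 *; set th := half_angle C e i in th0 xt xneq wt p't *.
have rayE q l y : vsub q O = (l * cos y, l * (s * sin y)) -> q = ray s O y l.
  by rewrite /ray [q]surjective_pairing /vsub /= => -[<- <-]; congr (_, _); ring.
move: k1 k2; rewrite (rayE _ _ _ pt) (rayE _ _ _ wt) (rayE _ _ _ p't) => k1 k2.
have [xlt|xgt|//] := ltrgtP x (t + th).
  have [l0 l00 H] := sector_interior O s1 r0 d0 th0 tx xlt.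
  by exists l0 => // l l1 l2; apply: filterS k1 _; exact: H.
have [|l0 l00 H] := sector_interior O s1 d0 r0 th0 xgt; first by rewrite -addrA -mulr2n.
exists l0 => // l l1 l2; apply: filterS k2 _; rewrite mulr2n addrA; exact: H.
Qed.

Variables (v : qV Q) (n : nat) (es : 'I_n -> qF Q) (idx : 'I_n -> 'I_4).
Hypothesis wv : qwhite Q v.
Hypothesis es_inj : injective es.
Hypothesis es_v : forall k, fv (es k) (idx k) = v.
Hypothesis angle_sum : \sum_(k < n) kite_angle C (es k) (idx k) = pi *+ 2.

Let wk k : qwhite Q (fv (es k) (idx k)).
Proof. by rewrite es_v. Qed.

(** No cyclic order of the star is given; [arcs_sum], applied to the arcs that the kites cut out of
    the circle of [v], replaces it. *)
Lemma star_telescope (F : pt R -> R) :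
  \sum_(k < n) F (ipt C (fv (es k) (nxt (nxt (nxt (idx k)))))) =
  \sum_(k < n) F (ipt C (fv (es k) (nxt (idx k)))).
Proof.
have s2 : s ^+ 2 = 1 by case: s1 => ->; ring.
set O := cen C v; set r := rad C v.
have r0 : 0 < r by exact: (rad_gt0 pattern wv).
have r00 : r != 0 by rewrite gt_eqF.
(* [N] carries the circle of [v] to the unit circle, with a reflection when [s = -1], and [N']
   undoes it. *)
pose N (q : pt R) : pt R := ((q.1 - O.1) / r, s * (q.2 - O.2) / r).
pose N' (u : pt R) : pt R := (O.1 + r * u.1, O.2 + r * (s * u.2)).
have NK q : N' (N q) = q.
  rewrite /N' /N /= [RHS]surjective_pairing; congr (_, _); first by field.
  by field: s2.
have Ndir q t : N q = (cos t, sin t) <-> vsub q O = (r * cos t, r * (s * sin t)).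
  split=> [[<- <-]|]; rewrite /vsub /N.
    by congr (_, _); field: s2.
  by move=> [-> ->]; congr (_, _); field: s2.
have polar_k k := corner_polar colors alpha_bounds pattern s1 orient (wk k).
transitivity (\sum_(k < n) (F \o N') (N (ipt C (fv (es k) (nxt (nxt (nxt (idx k)))))))).
  by apply: eq_bigr => k _; congr F; exact/esym/NK.
transitivity (\sum_(k < n) (F \o N') (N (ipt C (fv (es k) (nxt (idx k)))))); last first.
  by apply: eq_bigr => k _; congr F; exact/NK.
apply: (@arcs_sum _ n (fun k => half_angle C (es k) (idx k) *+ 2)
  (fun k => N (ipt C (fv (es k) (nxt (idx k)))))
  (fun k => N (ipt C (fv (es k) (nxt (nxt (nxt (idx k)))))))).
- by move=> k; have [_ /andP[th0 _] _ _ _] := polar_k k; rewrite mulrn_wgt0.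
- by move=> k; have [_ /andP[_ thpi] _ _ _] := polar_k k; rewrite ltr_pMn2r.
- by rewrite -angle_sum; apply: eq_bigr => k _; have [-> _ _ _ _] := polar_k k.
- move=> k; have [pO _ _ _] := corner_edist colors pattern (wk k).
  move: pO; rewrite es_v -/O -/r => pO; have := edist_sqr (ipt C (fv (es k) (nxt (idx k)))) O.
  by rewrite pO /N /= => E; field: s2 E.
- move=> k t /Ndir pt; apply/Ndir.
  by have [_ _ _ _ /(_ t)] := polar_k k; rewrite es_v => /(_ pt)[].
move=> j k t u jk /Ndir pj /Ndir pk.
set a := half_angle C (es j) (idx j); set b := half_angle C (es k) (idx k).
(* Overlapping arcs would share a direction [x] off both diagonals, and a point close to the centre
   in this direction would be interior to both kites. *)
apply: contrapT => /not_orP[/negP + /negP]; rewrite -!ltNge => tj uk.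
have [_ /andP[a0 _] _ _ _] := polar_k j; have [_ /andP[b0 _] _ _ _] := polar_k k.
have lt : Num.max t u < Num.min (t + a *+ 2) (u + b *+ 2).
  rewrite gt_max !lt_min uk tj !ltrDl !mulrn_wgt0 //.
have [x []] := exists_between_avoiding (t + a) (u + b) lt.
rewrite gt_max lt_min => /andP[tx ux] /andP[xt xu] xa xb.
have := @kite_sector (es j) (idx j) t x; rewrite es_v => /(_ wv pj tx xt xa)[l l0 Hj].
have := @kite_sector (es k) (idx k) u x; rewrite es_v => /(_ wv pk ux xu xb)[m m0 Hk].
have lm0 : 0 < Num.min l m / 2 by rewrite divr_gt0// lt_min l0.
have lm : Num.min l m / 2 < Num.min l m by lra.
move: (lm); rewrite {2}/Num.min lt_min => /andP[lml lmm].
have jk' : es j <> es k by move=> /es_inj; exact/eqP.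
suff : (interior (kite C (es j)) `&` interior (kite C (es k)))
    (ray s O x (Num.min l m / 2)) by rewrite kites_disjoint.
by split; [apply: Hj|apply: Hk].
Qed.
End Star.

(** * Hyperbolic angles *)

Section AngleShift.
Variable R : realType.
Implicit Types (x y t a b : R).

Lemma atan_polar x y : 0 < x -> exists2 m : R, 0 < m &
  x = m * cos (atan (y / x)) /\ y = m * sin (atan (y / x)).
Proof.
move=> x0; set q := atan (y / x).
have cq : 0 < cos q by apply: cos_gt0_pihalf; rewrite atan_gtNpi2 atan_ltpi2.
have sq : sin q = y / x * cos q by rewrite -(atanK (y / x)) -/q /tan divfK ?gt_eqF.
exists (x / cos q); first by rewrite divr_gt0.
by rewrite sq; split; field; rewrite ?gt_eqF.
Qed.

Definition shift a b t := atan ((a * sin t - b * cos t) / (1 - (a * cos t + b * sin t))).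

(* [shift a b t] is the argument of [1 - h / z] for [h = a + i b] and
   [z = exp (i t)], i.e. half the angle by which the Moebius map
   [z |-> (z - h) / (1 - conj h z)] moves [z].  The identity behind the proof is
   [e^(i th) w1 (conj w0) = (1 + |h|^2) cos th - 2 Re (h / mu) + i (1 - |h|^2) sin th]
   for the numbers [w0], [w1] at [z = mu e^(- i th)] and [z = mu e^(i th)]. *)
Lemma shift_arc a b t th : a ^+ 2 + b ^+ 2 < 1 -> 0 < th < pi ->
  let th' := th + (shift a b (t + th *+ 2) - shift a b t) in
  0 < th' < pi /\ exists2 m : R, 0 < m &
    m * cos th' = (1 + (a ^+ 2 + b ^+ 2)) * cos th
                   - 2 * (a * cos (t + th) + b * sin (t + th)) /\
    m * sin th' = (1 - (a ^+ 2 + b ^+ 2)) * sin th.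
Proof.
move=> ab1 /andP[th0 thpi] th'.
(* By Cauchy-Schwarz [1 - h / z] has positive real part, so [atan] of the quotient is its
   argument. *)
have X0 u : 0 < 1 - (a * cos u + b * sin u).
  have cu := cos2sin2 u; have : (a * cos u + b * sin u) ^+ 2 < 1.
    apply: le_lt_trans ab1; have -> : a ^+ 2 + b ^+ 2 =
      (a * cos u + b * sin u) ^+ 2 + (a * sin u - b * cos u) ^+ 2 by ring: cu.
    by rewrite lerDl sqr_ge0.
  by set x := _ + _; nra.
have [m0 m00 [c0 s0]] := atan_polar (a * sin t - b * cos t) (X0 t).
have [m1 m10 [c1 s1]] := atan_polar (a * sin (t + th *+ 2) - b * cos (t + th *+ 2)) (X0 (t + th *+ 2)).
rewrite -!/(shift a b _) in c0 s0 c1 s1.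
have mc : m0 * m1 * cos th' = (1 + (a ^+ 2 + b ^+ 2)) * cos th
                   - 2 * (a * cos (t + th) + b * sin (t + th)).
  rewrite /th' [cos (th + _)]cosD [cos (_ - shift _ _ _)]cosB [sin (_ - shift _ _ _)]sinB.
  transitivity (cos th * ((m1 * cos (shift a b (t + th *+ 2))) * (m0 * cos (shift a b t)) +
      (m1 * sin (shift a b (t + th *+ 2))) * (m0 * sin (shift a b t))) -
      sin th * ((m1 * sin (shift a b (t + th *+ 2))) * (m0 * cos (shift a b t)) -
      (m1 * cos (shift a b (t + th *+ 2))) * (m0 * sin (shift a b t)))); first by ring.
  rewrite -c0 -s0 -c1 -s1.
  have -> : t + th *+ 2 = (t + th) + th by ring.
  have -> : t = (t + th) - th by ring.
  set u := t + th; rewrite subrK -/u.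
  have cu := cos2sin2 u; have ct := cos2sin2 th.
  by rewrite cosD sinD cosB sinB; ring: cu ct.
have ms : m0 * m1 * sin th' = (1 - (a ^+ 2 + b ^+ 2)) * sin th.
  rewrite /th' [sin (th + _)]sinD [cos (_ - shift _ _ _)]cosB [sin (_ - shift _ _ _)]sinB.
  transitivity (sin th * ((m1 * cos (shift a b (t + th *+ 2))) * (m0 * cos (shift a b t)) +
      (m1 * sin (shift a b (t + th *+ 2))) * (m0 * sin (shift a b t))) +
      cos th * ((m1 * sin (shift a b (t + th *+ 2))) * (m0 * cos (shift a b t)) -
      (m1 * cos (shift a b (t + th *+ 2))) * (m0 * sin (shift a b t)))); first by ring.
  rewrite -c0 -s0 -c1 -s1.
  have -> : t + th *+ 2 = (t + th) + th by ring.
  have -> : t = (t + th) - th by ring.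
  set u := t + th; rewrite subrK -/u.
  have cu := cos2sin2 u; have ct := cos2sin2 th.
  by rewrite cosD sinD cosB sinB; ring: cu ct.
split; last by exists (m0 * m1) => //; rewrite mulr_gt0.
(* A positive sine fixes the range of [th'] only modulo [2 pi]. The bounds on [atan] confine [th']
   to [(-pi, 2 pi)], where the sine is positive on [(0, pi)] alone. *)
have sth' : 0 < sin th'.
  rewrite -(pmulr_rgt0 _ (mulr_gt0 m00 m10)) ms mulr_gt0//; first lra.
  by apply: sin_gt0_pi; rewrite th0.
have [l0 u0] := (atan_gtNpi2 ((a * sin t - b * cos t) / (1 - (a * cos t + b * sin t))),
  atan_ltpi2 ((a * sin t - b * cos t) / (1 - (a * cos t + b * sin t)))).
set t2 := t + th *+ 2.
have [l1 u1] := (atan_gtNpi2 ((a * sin t2 - b * cos t2) / (1 - (a * cos t2 + b * sin t2))),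
  atan_ltpi2 ((a * sin t2 - b * cos t2) / (1 - (a * cos t2 + b * sin t2)))).
rewrite -/(shift a b t) in l0 u0; rewrite -/(shift a b t2) in l1 u1.
have [lo hi] : - pi < th' /\ th' < pi + pi by rewrite /th' -/t2; split; lra.
apply/andP; split; rewrite ltNge; apply/negP => thle.
  suff : 0 <= sin (- th') by rewrite sinN; lra.
  by apply: sin_ge0_pi; lra.
suff : 0 <= sin (th' - pi) by rewrite sinB cospi sinpi; lra.
by apply: sin_ge0_pi; lra.
Qed.

End AngleShift.

Section Curvature.
Variable R : realType.
Implicit Types (c : pt R) (r : R).

(* The geodesic curvature, in the Poincare metric, of the circle with Euclidean
   centre [c] and radius [r]. *)
Definition kappa c r := (1 - dotp c c + r ^+ 2) / (2 * r).

Lemma kappaE c r : 0 < r -> 2 * r * kappa c r = 1 - dotp c c + r ^+ 2.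
Proof. by move=> r0; rewrite /kappa; field; rewrite gt_eqF. Qed.

Lemma kappa_inside c r : 0 < r -> enorm c + r < 1 ->
  [/\ 1 < kappa c r, r < kappa c r &
      dotp c c = (kappa c r - r) ^+ 2 - (kappa c r ^+ 2 - 1)].
Proof.
move=> r0 cr; have c0 := enorm_ge0 c; have c2 := enorm_sqr c.
have k := kappaE c r0; split; last 1 first.
- have -> : dotp c c = 1 + r ^+ 2 - 2 * r * kappa c r by rewrite k; ring.
  by ring.
- rewrite -(ltr_pM2l (_ : 0 < 2 * r)) ?mulr_gt0// k -c2; nra.
- rewrite -(ltr_pM2l (_ : 0 < 2 * r)) ?mulr_gt0// k -c2; nra.
Qed.

End Curvature.

(** * The hyperbolic angle sum at a vertex *)

Section HyperbolicStar.
Variables (R : realType) (Q : quad_graph R) (alpha : qF Q -> R) (C : cpattern Q).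
Hypothesis colors : forall f, [/\ qwhite Q (qfv Q f 0), ~~ qwhite Q (qfv Q f 1),
  qwhite Q (qfv Q f (inord 2)) & ~~ qwhite Q (qfv Q f (inord 3))].
Hypothesis alpha_bounds : forall e, 0 < alpha e < pi.
Hypothesis pattern : circle_pattern C alpha.
Hypothesis kites_disjoint : forall e e', e <> e' ->
  interior (kite C e) `&` interior (kite C e') = set0.
Local Notation fv := (qfv Q).

Definition scale (l : R) (z : pt R) : pt R := (l * z.1, l * z.2).

Definition scaled_kappa (l : R) v := kappa (scale l (cen C v)) (l * rad C v).

(** The law of cosines, with the angle [alpha e] at the intersection point. *)
Lemma white_dist e i : qwhite Q (fv e i) ->
  dotp (vsub (cen C (fv e (nxt (nxt i)))) (cen C (fv e i)))
       (vsub (cen C (fv e (nxt (nxt i)))) (cen C (fv e i))) =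
  rad C (fv e i) ^+ 2 + rad C (fv e (nxt (nxt i))) ^+ 2
    - 2 * rad C (fv e i) * rad C (fv e (nxt (nxt i))) * cos (alpha e).
Proof.
move=> wi; have [s s1 orient] := pattern_orientation colors pattern.
have [_ _ d0 [dc ds] _] := corner_polar colors alpha_bounds pattern s1 orient wi.
rewrite -enorm_sqr -/(edist _ _).
have polar_sqr d th : d ^+ 2 = (d * cos th) ^+ 2 + (d * sin th) ^+ 2 :> R.
  by rewrite !exprMn -mulrDr cos2Dsin2 mulr1.
by have ca := cos2sin2 (alpha e); rewrite [LHS](polar_sqr _ (half_angle C e i)) dc ds; ring: ca.
Qed.

Variables (v : qV Q) (n : nat) (es : 'I_n -> qF Q) (idx : 'I_n -> 'I_4).
Hypothesis wv : qwhite Q v.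
Hypothesis es_inj : injective es.
Hypothesis es_v : forall k, fv (es k) (idx k) = v.
Hypothesis angle_sum : \sum_(k < n) kite_angle C (es k) (idx k) = pi *+ 2.

(** A Moebius map preserving the circle of [v] and taking its hyperbolic centre to the Euclidean one
    turns hyperbolic angles at the former into arcs of the circle. It moves each intersection point
    by twice its [shift], so [shift_arc] gives the new half angles. The cotangent is stated
    multiplied out; no condition is put on the neighbouring scaled circles. *)
Lemma hyperbolic_angle_sum (l : R) : 0 < l ->
  enorm (scale l (cen C v)) + l * rad C v < 1 ->
  exists2 th : 'I_n -> R, \sum_(k < n) th k = pi & forall k,
    0 < th k < pi /\
    cos (th k) * (Num.sqrt (scaled_kappa l v ^+ 2 - 1) * sin (alpha (es k))) =
    sin (th k) * (scaled_kappa l (fv (es k) (nxt (nxt (idx k))))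
                  - scaled_kappa l v * cos (alpha (es k))).
Proof.
move=> l0 inside; have [s s1 orient] := pattern_orientation colors pattern.
have s2 : s ^+ 2 = 1 by case: s1 => ->; ring.
have r0 := rad_gt0 pattern wv; have lr0 : 0 < l * rad C v by rewrite mulr_gt0.
have r00 : rad C v != 0 by rewrite gt_eqF.
have [k1 kr cc] := kappa_inside lr0 inside.
rewrite -/(scaled_kappa l v) in k1 kr cc *.
set O := cen C v in cc *; set r := rad C v in r0 lr0 r00 kr cc *; set kv := scaled_kappa l v in k1 kr cc *.
set S := Num.sqrt (kv ^+ 2 - 1).
have S2 : S ^+ 2 = kv ^+ 2 - 1 by rewrite sqr_sqrtr//; nra.
have S0 : 0 < S by rewrite sqrtr_gt0; nra.
(* In the coordinate that makes the scaled circle of [v] the unit circle, its hyperbolic centre is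
   [eta] times the vector from 0 to its Euclidean centre; [a] and [b] are its components after the
   reflection by [s]. *)
pose eta := (kv - l * r + S)^-1.
have eta0 : 0 < eta by rewrite invr_gt0; lra.
have etaE : eta * (kv - l * r) + eta * S = 1.
  by rewrite -mulrDr mulVf// gt_eqF//; lra.
pose a := eta * (l * O.1); pose b := s * (eta * (l * O.2)).
have ab : a ^+ 2 + b ^+ 2 = 1 - 2 * (eta * S).
  have -> : a ^+ 2 + b ^+ 2 = eta ^+ 2 * dotp (scale l O) (scale l O).
    by rewrite /a /b /dotp /scale /=; ring: s2.
  rewrite cc -S2; transitivity ((eta * (kv - l * r)) ^+ 2 - (eta * S) ^+ 2); first by ring.
  have -> : eta * (kv - l * r) = 1 - eta * S by lra.
  by ring.
have ab1 : a ^+ 2 + b ^+ 2 < 1.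
  by have : 0 < eta * S; [rewrite mulr_gt0|rewrite ab; lra].
pose F (q : pt R) := let x := (q.1 - O.1) / r in let y := s * (q.2 - O.2) / r in
  atan ((a * y - b * x) / (1 - (a * x + b * y))).
have Fdir q t : vsub q O = (r * cos t, r * (s * sin t)) -> F q = shift a b t.
  rewrite /vsub => -[e1 e2]; rewrite /F /shift e1 e2.
  have -> : r * cos t / r = cos t by field.
  by have -> : s * (r * (s * sin t)) / r = sin t by field: s2.
pose p k := ipt C (fv (es k) (nxt (idx k))).
pose p' k := ipt C (fv (es k) (nxt (nxt (nxt (idx k))))).
have wk k : qwhite Q (fv (es k) (idx k)) by rewrite es_v.
exists (fun k => half_angle C (es k) (idx k) + (F (p' k) - F (p k))).
  rewrite big_split sumrB /= (star_telescope colors alpha_bounds pattern kites_disjoint s1 orient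
    wv es_inj es_v angle_sum) subrr addr0.
  suff : (\sum_(k < n) half_angle C (es k) (idx k)) *+ 2 = pi *+ 2 by lra.
  rewrite -sumrMnl -angle_sum; apply: eq_bigr => k _.
  by have [-> _ _ _ _] := corner_polar colors alpha_bounds pattern s1 orient (wk k).
move=> k; have [_ th0 d0 [dc ds] polarE] := corner_polar colors alpha_bounds pattern s1 orient (wk k).
have wd := white_dist (wk k).
have rw0 : 0 < rad C (fv (es k) (nxt (nxt (idx k)))) by apply: (rad_gt0 pattern); rewrite !white_nxt// negbK.
have [pO _ _ _] := corner_edist colors pattern (wk k).
have kw := kappaE (scale l (cen C (fv (es k) (nxt (nxt (idx k)))))) (mulr_gt0 l0 rw0).
rewrite -/(scaled_kappa _ _) in kw; have kvE := kappaE (scale l O) lr0.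
rewrite -/(scaled_kappa _ _) -/kv in kvE.
have := edist_sqr (ipt C (fv (es k) (nxt (idx k)))) O.
rewrite es_v -/r -/O in d0 dc ds wd pO polarE *.
rewrite -/(p k) -/(p' k) in pO polarE *.
rewrite pO => pO2.
move: th0 dc ds polarE; set th := half_angle C (es k) (idx k) => th0 dc ds polarE.
move: d0 dc ds wd polarE kw rw0; set w := cen C _; set rw := rad C _; set d := edist w O.
set al := alpha (es k); set kw := scaled_kappa l _ => d0 dc ds wd polarE kwE rw0.
have [|t [_ _ ct st]] := @polar _ (((p k).1 - O.1) / r) (s * ((p k).2 - O.2) / r) 0.
  by field: s2 pO2.
have pt : vsub (p k) O = (r * cos t, r * (s * sin t)).
  by rewrite -ct -st /vsub; congr (_, _); field: s2.
have [wt p't] := polarE t pt; rewrite (Fdir _ _ pt) (Fdir _ _ p't).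
have [th'0 [m m0 [mc ms]]] := shift_arc t ab1 th0; split=> //.
move: mc ms; set th' := th + _ => mc ms; rewrite ab in mc ms.
have m00 : m * d != 0 by rewrite gt_eqF// mulr_gt0.
have hw : d * (a * cos (t + th) + b * sin (t + th)) =
    eta * l * (O.1 * (w.1 - O.1) + O.2 * (w.2 - O.2)).
  have w1 : w.1 - O.1 = d * cos (t + th) := congr1 fst wt.
  have w2 : w.2 - O.2 = d * (s * sin (t + th)) := congr1 snd wt.
  by rewrite w1 w2 /a /b; ring.
have hw2 : 2 * l ^+ 2 * (O.1 * (w.1 - O.1) + O.2 * (w.2 - O.2)) =
    2 * (l * r) * kv - 2 * (l * rw) * kw - 2 * (l * r) ^+ 2
    + 2 * (l * r) * (l * rw) * cos al.
  rewrite kvE kwE; have := congr1 (fun x => l ^+ 2 * x) wd; rewrite /dotp /vsub /scale /=; lra.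
(* Cosine and sine of the hyperbolic half angle up to the common factor [l * m * d]; the cotangent
   is their quotient. *)
have Mc : (l * m * d) * cos th' = 2 * eta * (l * rw) * (kw - kv * cos al).
  transitivity (l * ((2 - 2 * (eta * S)) * (d * cos th)) -
     2 * l * (d * (a * cos (t + th) + b * sin (t + th)))).
    transitivity (l * d * (m * cos th')); first by ring.
    by rewrite mc; ring.
  rewrite hw dc; transitivity ((2 - 2 * (eta * S)) * (l * r - l * rw * cos al) -
     eta * (2 * l ^+ 2 * (O.1 * (w.1 - O.1) + O.2 * (w.2 - O.2)))); first by ring.
  rewrite hw2; have -> : eta * S = 1 - eta * (kv - l * r) by lra.
  by ring.
have Ms : (l * m * d) * sin th' = 2 * eta * (l * rw) * (S * sin al).
  transitivity (l * (2 * (eta * S)) * (d * sin th)).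
    transitivity (l * d * (m * sin th')); first by ring.
    by rewrite ms; ring.
  by rewrite ds; ring.
have M0 : l * m * d != 0 by rewrite gt_eqF// !mulr_gt0.
apply: (mulfI M0); transitivity ((l * m * d) * cos th' * (S * sin al)); first by ring.
by rewrite Mc; transitivity ((l * m * d) * sin th' * (kw - kv * cos al)); [rewrite Ms|]; ring.
Qed.
End HyperbolicStar.

(** * Comparison of the curvatures *)

Section Comparison.
Variable R : realType.
Implicit Types (k c x y t : R).

Lemma finite_argmax (T : Type) (A : set T) (f : T -> R) (x0 : T) : finite_set A -> A x0 ->
  exists2 x : T, A x & forall y : T, A y -> f y <= f x.
Proof.
move=> Afin Ax0; have /finite_seqP[s sE] := finite_image f Afin.
have [m ms mmax] : exists2 m, m \in s & forall y, y \in s -> y <= m.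
  have : f x0 \in s.
    have : (f @` A) (f x0) by exists x0.
    by rewrite sE.
  elim: s {sE} (f x0) => // y s IHs z _.
  case: s IHs => [_|z' s IHs]; first by exists y => [|u]; rewrite inE ?eqxx// => /eqP->.
  have [m ms mmax] := IHs _ (mem_head z' s).
  have [ym|my] := leP y m.
    by exists m => [|u]; rewrite inE ?ms ?orbT// => /orP[/eqP->//|]; exact: mmax.
  exists y => [|u]; rewrite inE ?eqxx// => /orP[/eqP->//|/mmax um].
  exact: le_trans um (ltW my).
have [x Ax fx] : (f @` A) m by rewrite sE.
exists x => // y Ay; rewrite fx; apply: mmax.
have : (f @` A) (f y) by exists y.
by rewrite sE.
Qed.

(* For [k = coth r] this is [tanh (r / 2)]. *)
Definition half_tanh k := k - Num.sqrt (k ^+ 2 - 1).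

Lemma half_tanhP k : 1 < k -> [/\ 0 < half_tanh k, half_tanh k < 1,
  2 * half_tanh k * k = 1 + half_tanh k ^+ 2 &
  2 * half_tanh k * Num.sqrt (k ^+ 2 - 1) = 1 - half_tanh k ^+ 2].
Proof.
move=> k1; rewrite /half_tanh; set S := Num.sqrt _.
have S2 : S ^+ 2 = k ^+ 2 - 1 by rewrite sqr_sqrtr//; nra.
have S0 : 0 <= S by exact: sqrtr_ge0.
split; [nra|nra| |]; ring: S2.
Qed.

(** The cotangent of a half angle times [sin a], where [c = cos a], [x] is [tanh (r / 2)] of the
    central circle and [k] is the curvature of the neighbour. In these variables it is a rational
    function. *)
Definition slope c x k := (2 * x * k - (1 + x ^+ 2) * c) / (1 - x ^+ 2).

Lemma slope_curvature c k k' : 1 < k ->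
  slope c (half_tanh k) k' = (k' - k * c) / Num.sqrt (k ^+ 2 - 1).
Proof.
move=> /half_tanhP[]; rewrite /slope; set t := half_tanh k; set S := Num.sqrt _ => t0 t1 tk tS.
have t2 : t ^+ 2 < 1 by nra.
have S0 : 0 < S by nra.
rewrite -tS -tk; field; rewrite !gt_eqF//.
Qed.

Lemma slope_ge c x k k' : 0 < x -> x < 1 -> k <= k' -> slope c x k <= slope c x k'.
Proof.
move=> x0 x1 kk'; have x2 : 0 < 1 - x ^+ 2 by nra.
by rewrite /slope ler_pM2r ?invr_gt0//; nra.
Qed.

Lemma slope_lt_l c x y k : -1 < c < 1 -> 0 < x -> x < y -> y < 1 -> 1 <= k ->
  slope c x k < slope c y k.
Proof.
move=> /andP[c0 c1] x0 xy y1 k1.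
have x2 : 0 < 1 - x ^+ 2 by nra.
have y2 : 0 < 1 - y ^+ 2 by nra.
rewrite /slope ltr_pdivrMr// [X in _ < X]mulrAC ltr_pdivlMr// -subr_gt0.
have -> : (2 * y * k - (1 + y ^+ 2) * c) * (1 - x ^+ 2) -
   (2 * x * k - (1 + x ^+ 2) * c) * (1 - y ^+ 2) =
   2 * (y - x) * (k * (1 + x * y) - c * (x + y)) by ring.
rewrite mulr_gt0 ?mulr_gt0 ?subr_gt0//.
have h1 : x + y < 1 + x * y by nra.
have h2 : 1 + x * y <= k * (1 + x * y) by nra.
have h3 : c * (x + y) < x + y by nra.
lra.
Qed.

(** Enlarging both values of [tanh (r / 2)] by the same factor shrinks the angle. The difference has
    the sign of [x ^ 2 + y ^ 2 - 2 x y c], the squared third side of a Euclidean triangle. *)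
Lemma slope_lt_diag c x y m : -1 < c < 1 -> 0 < x -> 0 < y -> y < 1 -> 1 < m -> m * x < 1 ->
  slope c x ((1 + y ^+ 2) / (2 * y)) < slope c (m * x) ((1 + (m * y) ^+ 2) / (2 * (m * y))).
Proof.
move=> /andP[c0 c1] x0 y0 y1 m1 mx1.
have x2 : 0 < 1 - x ^+ 2 by nra.
have X0 : 0 < m * x by nra.
have X2 : 0 < 1 - (m * x) ^+ 2 by nra.
rewrite /slope ltr_pdivrMr// [X in _ < X]mulrAC ltr_pdivlMr// -subr_gt0.
set lhs := (X in 0 < X).
have -> : lhs = (m ^+ 2 - 1) * (x / y) * (x ^+ 2 + y ^+ 2 - 2 * x * y * c).
  rewrite /lhs; field; rewrite !gt_eqF//; lra.
rewrite mulr_gt0 ?mulr_gt0 ?invr_gt0//; first nra.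
have xy : 0 < x * y by rewrite mulr_gt0.
have : 0 <= (x - y) ^+ 2 by rewrite sqr_ge0.
nra.
Qed.

(** If [kw <= 1], raise the neighbour's curvature to 1, then enlarge the central circle, then pass
    to [kw']. Otherwise enlarge both circles by [m], but stop at the factor [y^-1] if the neighbour
    reaches curvature 1 before that, and go on as in the first case. *)
Lemma slope_comparison c k k' kw kw' m : -1 < c < 1 -> 1 < k -> 1 < k' -> 1 < kw' -> 1 < m ->
  half_tanh k' = m * half_tanh k ->
  kw <= 1 \/ 1 < kw /\ half_tanh kw' <= m * half_tanh kw ->
  (kw - k * c) / Num.sqrt (k ^+ 2 - 1) < (kw' - k' * c) / Num.sqrt (k' ^+ 2 - 1).
Proof.
move=> cb k1 k'1 kw'1 m1 mE kwE; rewrite -!slope_curvature// mE.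
have [x0 x1 _ _] := half_tanhP k1; have [_ X1 _ _] := half_tanhP k'1.
rewrite mE in X1; set x := half_tanh k in x0 x1 X1 *.
have X0 : 0 < m * x by nra.
have xX : x < m * x by nra.
case: kwE => [kw1|[kw1 yy]].
  apply: (le_lt_trans (slope_ge c x0 x1 kw1)).
  apply: (lt_le_trans (slope_lt_l cb x0 xX X1 (lexx 1))).
  exact: (slope_ge c X0 X1 (ltW kw'1)).
have [y0 y1 yE _] := half_tanhP kw1; have [Y0 Y1 YE _] := half_tanhP kw'1.
set y := half_tanh kw in yy y0 y1 yE; set Y := half_tanh kw' in yy Y0 Y1 YE.
have -> : kw = (1 + y ^+ 2) / (2 * y) by rewrite -yE; field; rewrite gt_eqF.
have [my1|my1] := leP (m * y) 1.
  apply: (lt_le_trans (slope_lt_diag cb x0 y0 y1 m1 X1)); apply: slope_ge => //.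
  have -> : kw' = (1 + Y ^+ 2) / (2 * Y) by rewrite -YE; field; rewrite gt_eqF.
  have my0 : 0 < m * y by nra.
  have my2 : 0 < 2 * (m * y) by lra.
  have Y2 : 0 < 2 * Y by lra.
  rewrite (ler_pdivrMr _ _ my2) [X in _ <= X]mulrAC (ler_pdivlMr _ _ Y2).
  set z := m * y in my0 my1 yy *; rewrite -subr_ge0.
  have -> : (1 + Y ^+ 2) * (2 * z) - (1 + z ^+ 2) * (2 * Y) = 2 * ((z - Y) * (1 - z * Y)) by ring.
  by rewrite mulr_ge0// mulr_ge0//; nra.
have ym : y^-1 < m by rewrite -(ltr_pM2r y0) mulVf ?gt_eqF.
have y'1 : 1 < y^-1 by rewrite invf_gt1.
have xy : y^-1 * x < m * x by rewrite ltr_pM2r.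
have := @slope_lt_diag c x y y^-1 cb x0 y0 y1 y'1 (lt_trans xy X1).
rewrite mulVf ?gt_eqF// expr1n mulr1 divff ?pnatr_eq0 // => H; apply: (lt_trans H).
apply: lt_le_trans (slope_ge c X0 X1 (ltW kw'1)).
by apply: slope_lt_l => //; rewrite mulr_gt0// invr_gt0.
Qed.

Lemma angle_lt (a b u v : R) : 0 < a < pi -> 0 < b < pi -> u < v ->
  cos a = sin a * u -> cos b = sin b * v -> b < a.
Proof.
move=> /andP[a0 api] /andP[b0 bpi] uv ca cb.
have sa : 0 < sin a by apply: sin_gt0_pi; rewrite a0.
have sb : 0 < sin b by apply: sin_gt0_pi; rewrite b0.
have sab : 0 < sin (a - b).
  rewrite sinB ca cb (_ : _ - _ = sin a * sin b * (v - u)); last by ring.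
  by rewrite !mulr_gt0// subr_gt0.
rewrite ltNge; apply/negP => ab.
have : 0 <= sin (b - a) by apply: sin_ge0_pi; lra.
by rewrite -opprB sinN; lra.
Qed.

End Comparison.

Section Norm.
Variable R : realType.
Implicit Types z w : pt R.

Lemma enorm_le_edist z w : enorm z <= enorm w + edist z w.
Proof.
have w0 := enorm_ge0 w; have d0 := enorm_ge0 (vsub z w).
rewrite -(@ler_pXn2r _ 2) ?nnegrE ?addr_ge0 ?enorm_ge0// sqrrD /edist !enorm_sqr.
have h : dotp w (vsub z w) <= enorm w * enorm (vsub z w).
  apply: le_trans (ler_norm _) _.
  rewrite -(@ler_pXn2r _ 2) ?nnegrE ?mulr_ge0// real_normK ?num_real// exprMn !enorm_sqr.
  rewrite -subr_ge0 [X in 0 <= X](_ : _ = detp w (vsub z w) ^+ 2) ?sqr_ge0//.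
  by rewrite /dotp /detp; ring.
have -> : dotp z z = dotp w w + 2 * dotp w (vsub z w) + dotp (vsub z w) (vsub z w).
  by rewrite /dotp /vsub /=; ring.
by rewrite lerD2r lerD2l mulr_natl ler_wMn2r.
Qed.

Lemma edist_le_enorm z w : edist z w <= enorm z + enorm w.
Proof.
have := enorm_le_edist (vsub z w) z; congr (_ <= _ + _).
by rewrite /edist /enorm; congr Num.sqrt; rewrite /dotp /vsub /=; ring.
Qed.

Lemma enorm_scale (l : R) z : 0 <= l -> enorm (scale l z) = l * enorm z.
Proof.
move=> l0; apply/eqP; rewrite -(@eqrXn2 _ 2) ?mulr_ge0 ?enorm_ge0// exprMn !enorm_sqr.
by apply/eqP; rewrite /dotp /scale /=; ring.
Qed.

Lemma udisc_enorm z : udisc R z <-> enorm z < 1.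
Proof.
by rewrite /udisc /= -enorm_sqr expr_lt1 ?enorm_ge0.
Qed.

Lemma compact_disc (r : R) : compact [set z : pt R | dotp z z <= r].
Proof.
apply: (@subclosed_compact _ _ (`[- (r + 1), r + 1]%classic `*` `[- (r + 1), r + 1]%classic)).
- have cont : continuous (fun z : pt R => dotp z z).
    move=> z; apply: cvgD.
      by apply: cvgM; apply: cvg_fst.
    by apply: cvgM; apply: cvg_snd.
  exact: (continuous_closedP _).1 cont _ (@closed_le _ r).
- by apply: compact_setX; exact: segment_compact.
move=> z; rewrite /dotp /= => zr.
have h1 : 0 <= z.1 * z.1 by rewrite -expr2 sqr_ge0.
have h2 : 0 <= z.2 * z.2 by rewrite -expr2 sqr_ge0.
by split; rewrite /= in_itv /=; apply/andP; split; nra.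
Qed.

End Norm.

(** * The maximum principle for the curvatures *)

Section Rigidity.
Variables (R : realType) (Q : quad_graph R).
Hypothesis disc : bquad_graph_of_disc Q.
Local Notation fv := (qfv Q).

Let colors : forall f, [/\ qwhite Q (qfv Q f 0), ~~ qwhite Q (qfv Q f 1),
  qwhite Q (qfv Q f (inord 2)) & ~~ qwhite Q (qfv Q f (inord 3))].
Proof. by case: disc. Qed.

Lemma corner_csquare i : csquare (corner R i).
Proof.
by move: i; apply: ord4P; rewrite /csquare /corner /= ?inordK//= ?lexx ?ler01.
Qed.

Lemma corner_inj : injective (corner R).
Proof.
by move=> i j; move: i; apply: ord4P; move: j; apply: ord4P => //;
  rewrite /corner /= ?inordK//= => /eqP; rewrite xpair_eqE ?(eq_sym (0 : R) 1) ?oner_eq0 ?eqxx.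
Qed.

Lemma fv_inj f : injective (fv f).
Proof.
case: disc => _ [cellP [cornerE _]] i j ij.
have [_ cinj] := cellP f; apply: corner_inj; apply: cinj; rewrite ?inE;
  [exact: corner_csquare|exact: corner_csquare|by rewrite !cornerE ij].
Qed.

(** Each pattern brings its own enumeration of the star of [v]; this makes one enumeration serve
    both. The index of [v] in a face is determined by [fv_inj]. *)
Lemma star_sum_enum v g x : star_sum v g x ->
  forall n (es : 'I_n -> qF Q) (idx : 'I_n -> 'I_4), injective es ->
    (forall k, fv (es k) (idx k) = v) ->
    (forall f i, fv f i = v -> exists k, es k = f) ->
    \sum_(k < n) g (es k) (idx k) = x.
Proof.
move=> [m [fs [jdx [fs_inj fs_v fs_all <-]]]] n es idx es_inj es_v es_all.
have /choice[t tE] : forall k, exists j, es j = fs k by move=> k; exact: es_all (fs_v k).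
have /choice[u uE] : forall k, exists j, fs j = es k by move=> k; exact: fs_all (es_v k).
rewrite (reindex t) /=; last first.
  by exists u => k _; [apply: fs_inj; rewrite uE tE|apply: es_inj; rewrite tE uE].
apply: eq_bigr => k _; rewrite tE; congr g; apply: (@fv_inj (fs k)).
by rewrite fs_v -{1}tE es_v.
Qed.

Section Patterns.
Variables (alpha : qF Q -> R).
Hypothesis adm : admissible alpha.
Let alpha_bounds : forall e, 0 < alpha e < pi.
Proof. by case: adm. Qed.

Lemma circle_inside (C : cpattern Q) v : circle_pattern C alpha -> contained_in_disc C ->
  qwhite Q v -> enorm (cen C v) + rad C v < 1.
Proof.
move=> pattern sub wv; have r0 := rad_gt0 pattern wv.
set c := cen C v; set r := rad C v in r0 *; have c0 := enorm_ge0 c.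
(* The point of the circle farthest from 0 lies on the ray through the centre; if the centre is 0,
   any point will do. *)
have [z zc zE] : exists2 z : pt R, edist z c = r & enorm z = enorm c + r.
  have [ce|cn] := eqVneq (enorm c) 0.
    have cc : c = (0, 0).
      have := enorm_sqr c; rewrite ce expr0n /dotp => /esym/eqP.
      rewrite -!expr2 paddr_eq0 ?sqr_ge0// !sqrf_eq0 => /andP[/eqP c1 /eqP c2].
      by rewrite [c]surjective_pairing c1 c2.
    exists (r, 0); apply/eqP; rewrite -(@eqrXn2 _ 2) ?enorm_ge0 ?addr_ge0 ?(ltW r0)//.
      by rewrite edist_sqr cc /=; apply/eqP; ring.
    by rewrite enorm_sqr ce /dotp /=; apply/eqP; ring.
  have cp : 0 < enorm c by rewrite lt_def cn.
  pose k := 1 + r / enorm c; have k0 : 0 < k by rewrite addr_gt0 ?divr_gt0.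
  exists (scale k c).
    apply/eqP; rewrite -(@eqrXn2 _ 2) ?enorm_ge0 ?(ltW r0)//.
    apply/eqP; rewrite edist_sqr /scale /=.
    transitivity ((r / enorm c) ^+ 2 * dotp c c); first by rewrite /k /dotp; ring.
    by rewrite -enorm_sqr -exprMn divfK.
  by rewrite enorm_scale ?(ltW k0)// /k; field.
by rewrite -zE; apply/udisc_enorm; apply: (sub v).
Qed.

Lemma scaled_kappa1 (C : cpattern Q) v : scaled_kappa C 1 v = kappa (cen C v) (rad C v).
Proof. by rewrite /scaled_kappa /scale !mul1r -surjective_pairing. Qed.

Section Comparison.
Variables C Ct : cpattern Q.
Hypothesis (patC : circle_pattern C alpha) (embC : embedded C)
  (finC : locally_finite_in_disc C) (inC : contained_in_disc C).
Hypothesis (patCt : circle_pattern Ct alpha) (embCt : embedded Ct)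
  (inCt : contained_in_disc Ct).

Let inside l v := enorm (scale l (cen C v)) + l * rad C v < 1.

(** For such [v] the unscaled centre lies in the disc of radius [1 / l], which is compact in the
    open unit disc, and every centre is a corner of some kite. *)
Lemma inside_finite l : 1 < l -> finite_set [set v | qwhite Q v /\ inside l v].
Proof.
move=> l1; have l0 : 0 < l by lra.
pose K := [set z : pt R | dotp z z <= (l^-1) ^+ 2].
have KE z : K z <-> l * enorm z <= 1.
  rewrite /K /= -enorm_sqr ler_pXn2r ?nnegrE ?enorm_ge0 ?invr_ge0 ?(ltW l0)//.
  by rewrite -[l^-1]mul1r ler_pdivlMr// mulrC.
have Kdisc : K `<=` udisc R by move=> z /KE lz; apply/udisc_enorm; have := enorm_ge0 z; nra.
have Kcompact : compact K := @compact_disc R _.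
have Ffin := finC Kcompact Kdisc.
have : finite_set ((fun e => fv e 0) @` [set e | kite C e `&` K !=set0] `|`
    (fun e => fv e (inord 2)) @` [set e | kite C e `&` K !=set0]).
  by rewrite finite_setU; split; exact: finite_image.
apply: sub_finite_set => v [wv vin].
have [_ [_ [_ [[_ vface] _]]]] := disc; have [e [i eiv]] := vface v.
have Kc : K (cen C v).
  by apply/KE; rewrite -enorm_scale ?(ltW l0)//; have := rad_gt0 patC wv; move: vin; rewrite /inside; nra.
have kc : kite C e (cen C v).
  have [k1 _] := corner_kite C colors (etrans (congr1 _ eiv) wv); apply: k1.
  exists 1, 0, 0; split=> //; first lra.
  by rewrite eiv [LHS]surjective_pairing; congr (_, _); ring.
have [c0 c1 c2 c3] := colors e.
have eF : [set e | kite C e `&` K !=set0] e by exists (cen C v).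
move: eiv wv; move: i; apply: ord4P => <-; rewrite ?(negPf c1) ?(negPf c3)// => _.
  by left; exists e.
by right; exists e.
Qed.

Lemma scaled_kappa_le l v : 1 < l -> qwhite Q v -> inside l v ->
  scaled_kappa C l v <= kappa (cen Ct v) (rad Ct v).
Proof.
move=> l1; have l0 : 0 < l by lra.
rewrite -scaled_kappa1 => wv0 inv0; rewrite leNgt; apply/negP => klt.
pose k u := scaled_kappa C l u; pose k' u := scaled_kappa Ct 1 u.
have kin u : qwhite Q u -> inside l u -> 1 < k u.
  by move=> wu iu; have [] := kappa_inside (mulr_gt0 l0 (rad_gt0 patC wu)) iu.
have k'in u : qwhite Q u -> 1 < k' u.
  move=> wu; rewrite /k' scaled_kappa1.
  by have [] := kappa_inside (rad_gt0 patCt wu) (circle_inside patCt inCt wu).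
pose ratio u := half_tanh (k' u) / half_tanh (k u).
have [u [wu iu] umax] := @finite_argmax _ _ _ ratio v (inside_finite l1) (conj wv0 inv0).
have tk w : qwhite Q w -> inside l w -> 0 < half_tanh (k w).
  by move=> ww iw; have [] := half_tanhP (kin w ww iw).
(* [half_tanh] is decreasing, so the assumed inequality at [v] already makes the ratio at [v] exceed
   1. *)
pose m := ratio u; have m1 : 1 < m.
  apply: lt_le_trans (umax v (conj wv0 inv0)); rewrite /ratio ltr_pdivlMr ?tk// mul1r.
  have [t0 t1 tE _] := half_tanhP (kin v wv0 inv0).
  have [t'0 t'1 t'E _] := half_tanhP (k'in v wv0).
  rewrite ltNge; apply/negP => le_t; move: klt; rewrite -/(k v) -/(k' v) ltNge => /negP; apply.
  move: (half_tanh (k v)) (half_tanh (k' v)) t0 t1 tE t'0 t'1 t'E le_t => t t' t0 t1 tE t'0 t'1 t'E le_t.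
  have tt : 0 < 2 * t * t' by rewrite !mulr_gt0.
  rewrite -(ler_pM2l tt).
  have -> : 2 * t * t' * k v = t' * (1 + t ^+ 2) by rewrite -tE; ring.
  have -> : 2 * t * t' * k' v = t * (1 + t' ^+ 2) by rewrite -t'E; ring.
  rewrite -subr_ge0 (_ : _ - _ = (t - t') * (1 - t * t')); last by ring.
  by rewrite mulr_ge0//; nra.
have starC : star_sum u (kite_angle C) (2 * pi) by case: patC => _ [_ [_ [_ [_ H]]]]; exact: H.
have starCt : star_sum u (kite_angle Ct) (2 * pi) by case: patCt => _ [_ [_ [_ [_ H]]]]; exact: H.
have [n [es [idx [es_inj es_v es_all sumC]]]] := starC.
have sumCt := star_sum_enum starCt es_inj es_v es_all.
rewrite mulr_natl in sumC; rewrite mulr_natl in sumCt.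
have [th thsum thP] := hyperbolic_angle_sum colors alpha_bounds patC embC.1 wu es_inj es_v sumC l0 iu.
have iu' : enorm (scale 1 (cen Ct u)) + 1 * rad Ct u < 1.
  by rewrite enorm_scale ?ler01// !mul1r; exact: circle_inside.
have [th' th'sum th'P] := hyperbolic_angle_sum colors alpha_bounds patCt embCt.1 wu es_inj es_v sumCt ltr01 iu'.
(* Both families of half angles add up to [pi], which is positive, so the star is not empty and a
   strict inequality for every [j] is absurd. *)
suff lt_th j : th' j < th j.
  have n0 : (0 < n)%N.
    case: n th {thP es idx es_inj es_v es_all sumC sumCt th' th'sum th'P lt_th} thsum => // th.
    by rewrite big_ord0; have := pi_gt0 R; lra.
  have := pi_gt0 R; rewrite -{1}th'sum.
  have : \sum_(j < n) (th j - th' j) == 0 by rewrite sumrB thsum th'sum subrr.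
  rewrite psumr_eq0 => [/allP/(_ (Ordinal n0))|j _]; last by rewrite subr_ge0 ltW.
  by rewrite mem_index_enum => /(_ isT); rewrite /= subr_eq0 gt_eqF// lt_th.
have [thj Ej] := thP j; have [th'j E'j] := th'P j.
set w := fv (es j) (nxt (nxt (idx j))) in Ej E'j.
have wj : qwhite Q (fv (es j) (idx j)) by rewrite es_v.
have ww : qwhite Q w by rewrite /w !(white_nxt colors) negbK.
rewrite -/(k u) -/(k w) in Ej; rewrite -/(k' u) -/(k' w) in E'j.
have /andP[a0 api] := alpha_bounds (es j).
have sa : 0 < sin (alpha (es j)) by apply: sin_gt0_pi; rewrite a0.
have cab : -1 < cos (alpha (es j)) < 1 by have := cos2Dsin2 (alpha (es j)); nra.
have S0 (x : R) : 1 < x -> 0 < Num.sqrt (x ^+ 2 - 1) by move=> x1; rewrite sqrtr_gt0; nra.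
have S1 := S0 _ (kin u wu iu); have S2 := S0 _ (k'in u wu); move: S1 S2.
set S := Num.sqrt (k u ^+ 2 - 1) in Ej *; set S' := Num.sqrt (k' u ^+ 2 - 1) in E'j * => S'1 S'0.
apply: (@angle_lt _ (th j) (th' j) ((k w - k u * cos (alpha (es j))) / S / sin (alpha (es j)))
  ((k' w - k' u * cos (alpha (es j))) / S' / sin (alpha (es j)))) => //.
- rewrite ltr_pM2r ?invr_gt0//.
  apply: (@slope_comparison _ _ _ _ _ _ m) => //; [exact: kin|exact: k'in|exact: k'in| |].
    by rewrite /m /ratio divfK// gt_eqF// tk.
  have [iw|niw] := pselect (inside l w).
    right; split; first exact: kin.
    by rewrite -ler_pdivrMr ?tk//; exact: umax.
  (* Curvature at most 1 means [|1 - l * r| <= l * |c|] for the circle of [w]. One bound says that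
     the scaled circle is not inside; the other that it does not surround the disc, which holds as
     it shares a point with the circle of [u], which is inside. *)
  left; have r0 := rad_gt0 patC ww.
  have lr0 : 0 < l * rad C w by rewrite mulr_gt0.
  have kE := kappaE (scale l (cen C w)) lr0; rewrite -/(scaled_kappa C l w) -/(k w) in kE.
  move: niw => /negP; rewrite -leNgt => out.
  have [pO _ pw _] := corner_edist colors patC wj; rewrite -/w es_v in pO pw.
  have e1 := enorm_le_edist (ipt C (fv (es j) (nxt (idx j)))) (cen C u); rewrite pO in e1.
  have e3 := edist_le_enorm (ipt C (fv (es j) (nxt (idx j)))) (cen C w); rewrite pw in e3.
  rewrite /inside enorm_scale ?(ltW l0)// in iu.
  have e4 : l * enorm (ipt C (fv (es j) (nxt (idx j)))) < 1 by nra.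
  have e5 : l * rad C w < 1 + enorm (scale l (cen C w)) by rewrite enorm_scale ?(ltW l0)//; nra.
  rewrite -(ler_pM2l (_ : 0 < 2 * (l * rad C w))) ?mulr_gt0// kE -enorm_sqr.
  by have := enorm_ge0 (scale l (cen C w)); nra.
- apply: (mulIf (lt0r_neq0 (mulr_gt0 S'1 sa))); rewrite Ej; field.
  by rewrite !gt_eqF.
- apply: (mulIf (lt0r_neq0 (mulr_gt0 S'0 sa))); rewrite E'j; field.
  by rewrite !gt_eqF.
Qed.

Lemma kappa_le v : qwhite Q v -> kappa (cen C v) (rad C v) <= kappa (cen Ct v) (rad Ct v).
Proof.
move=> wv; have r0 := rad_gt0 patC wv; have ins := circle_inside patC inC wv.
set c := cen C v in ins *; set r := rad C v in r0 ins *; have c0 := enorm_ge0 c.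
set X := kappa (cen Ct v) _; set B := dotp c c - r ^+ 2.
rewrite leNgt; apply/negP => Xlt.
have f0 : 0 < 1 - B - 2 * r * X.
  have := kappaE c r0; rewrite /B; have : 2 * r * X < 2 * r * kappa c r by rewrite ltr_pM2l// mulr_gt0.
  by lra.
(* For [e <= 1] this bounds the coefficient of [- e] in the expansion of the inequality at
   [l = 1 + e]; the summand 1 keeps [M] positive. *)
set M := `|2 * B + 2 * r * X| + `|B| + 1.
have M0 : 0 < M by rewrite ltr_wpDl// addr_ge0.
have [e [e0 e1 eM ein]] : exists e : R, [/\ 0 < e, e <= 1, e * M < 1 - B - 2 * r * X &
    (1 + e) * (enorm c + r) < 1].
  pose e := Num.min 1 (Num.min ((1 - B - 2 * r * X) / (2 * M)) ((1 - (enorm c + r)) / 2)).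
  have [ea eb ec] : [/\ e <= 1, e <= (1 - B - 2 * r * X) / (2 * M) & e <= (1 - (enorm c + r)) / 2].
    by rewrite /e !ge_min !lexx !orbT.
  have e0 : 0 < e by rewrite /e !lt_min ltr01 !divr_gt0// ?mulr_gt0// subr_gt0.
  exists e; split=> //; last by nra.
  have : e * M <= (1 - B - 2 * r * X) / (2 * M) * M by rewrite ler_pM2r.
  have -> : (1 - B - 2 * r * X) / (2 * M) * M = (1 - B - 2 * r * X) / 2 by field; rewrite gt_eqF.
  lra.
have l1 : 1 < 1 + e by lra.
have := @scaled_kappa_le (1 + e) v l1 wv; rewrite /inside enorm_scale; last lra.
rewrite -mulrDr => /(_ ein); rewrite -/X leNgt => /negP; apply.
have lr : 0 < (1 + e) * r by rewrite mulr_gt0//; lra.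
have lr2 : 0 < 2 * ((1 + e) * r) by rewrite mulr_gt0.
have kE : 2 * ((1 + e) * r) * scaled_kappa C (1 + e) v = _ := kappaE _ lr.
rewrite -(ltr_pM2l lr2) kE.
have -> : dotp (scale (1 + e) (cen C v)) (scale (1 + e) (cen C v)) = (1 + e) ^+ 2 * (B + r ^+ 2).
  by rewrite /B -/c /dotp /scale /=; ring.
rewrite -subr_gt0.
have -> : 1 - (1 + e) ^+ 2 * (B + r ^+ 2) + ((1 + e) * r) ^+ 2 - 2 * ((1 + e) * r) * X =
  (1 - B - 2 * r * X) - e * ((2 * B + 2 * r * X) + e * B) by ring.
rewrite subr_gt0; apply: le_lt_trans eM; rewrite ler_pM2l// /M.
have h1 := ler_norm (2 * B + 2 * r * X).
have h2 : e * B <= `|B|.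
  apply: le_trans (ler_norm _) _; rewrite normrM gtr0_norm//.
  by rewrite -[leRHS]mul1r ler_wpM2r.
lra.
Qed.
End Comparison.
End Patterns.
End Rigidity.

(** * Connectivity of the faces *)

Section PlaneTopology.
Variable R : realType.
Implicit Types (p q m x : pt R).

Lemma plane_compact_closed (A : set (pt R)) : compact A -> closed A.
Proof. by apply: compact_closed; exact: norm_hausdorff. Qed.

Definition segment_point p q (t : R) : pt R :=
  ((1 - t) * p.1 + t * q.1, (1 - t) * p.2 + t * q.2).

Lemma segment_point_continuous p q : continuous (segment_point p q).
Proof.
have affine (a b : R) : continuous (fun t : R => (1 - t) * a + t * b).
  move=> t; apply: cvgD; last by apply: cvgM; [apply: cvg_id|apply: cvg_cst].
  apply: cvgM; last by apply: cvg_cst.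
  apply: cvgB; first by apply: cvg_cst.
  by apply: cvg_id.
by move=> t; exact: (cvg_pair (affine _ _ t) (affine _ _ t)).
Qed.

Definition segment p q : set (pt R) := segment_point p q @` `[0, 1]%classic.

Lemma compact_segment p q : compact (segment p q).
Proof.
apply: continuous_compact; last exact: segment_compact.
by apply: continuous_subspaceT; exact: segment_point_continuous.
Qed.

Lemma connected_segment p q : connected (segment p q).
Proof.
apply: connected_continuous_connected; last first.
  by apply: continuous_subspaceT; exact: segment_point_continuous.
by apply/connected_intervalP; exact: interval_is_interval.
Qed.

Lemma segment_l p q : segment p q p.
Proof.
exists 0; first by rewrite /= in_itv /= lexx ler01.
by rewrite /segment_point subr0 !mul1r !mul0r !addr0 -surjective_pairing.
Qed.

Lemma segment_r p q : segment p q q.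
Proof.
exists 1; first by rewrite /= in_itv /= lexx ler01.
by rewrite /segment_point subrr !mul1r !mul0r !add0r -surjective_pairing.
Qed.

Lemma segment_ball p q (r : R) : dotp p p <= r -> dotp q q <= r ->
  segment p q `<=` [set z | dotp z z <= r].
Proof.
move=> pr qr _ [t /= + <-]; rewrite in_itv /= => /andP[t0 t1].
rewrite /dotp /segment_point /=; move: pr qr; rewrite /dotp => pr qr.
have t1' : 0 <= 1 - t by rewrite subr_ge0.
have : 0 <= t * (1 - t) * ((p.1 - q.1) ^+ 2 + (p.2 - q.2) ^+ 2).
  by apply: mulr_ge0; [exact: mulr_ge0|rewrite addr_ge0 ?sqr_ge0].
have : (1 - t) * (p.1 * p.1 + p.2 * p.2) <= (1 - t) * r by rewrite ler_wpM2l.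
have : t * (q.1 * q.1 + q.2 * q.2) <= t * r by rewrite ler_wpM2l.
by lra.
Qed.

Lemma connected_two_closed (T : topologicalType) (S A B : set T) : connected S ->
  closed A -> closed B -> S `<=` A `|` B -> S `&` A `&` B = set0 ->
  S `&` A !=set0 -> S `<=` A.
Proof.
move=> cS cA cB SAB SAB0 SA0.
have SAE : S `&` A = S.
  apply: cS => //; last by exists A.
  exists (~` B); first exact: closed_openC.
  rewrite eqEsubset; split=> x [Sx Ax]; split=> //.
    by move=> Bx; have : (S `&` A `&` B) x by []; rewrite SAB0.
  by have [] := SAB x Sx.
by rewrite -SAE => x [].
Qed.

Lemma finite_set_avoid (X : set R) (a b : R) : finite_set X -> a < b ->
  exists t, [/\ a < t, t < b & ~ X t].
Proof.
move=> /finite_seqP[s ->]; elim: s a b => [|y s IHs] a b ab.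
  by exists ((a + b) / 2); split; [lra|lra|].
have [ya|ay] := leP y a.
  have [t [at_ tb ts]] := IHs a b ab; exists t; split=> //=.
  by rewrite inE => /orP[/eqP ty|//]; lra.
have [yb|by_] := ltP y b; last first.
  have [t [at_ tb ts]] := IHs a b ab; exists t; split=> //=.
  by rewrite inE => /orP[/eqP ty|//]; lra.
have [t [at_ tb ts]] := IHs a y ay; exists t; split=> //=; first lra.
by rewrite inE => /orP[/eqP ty|//]; lra.
Qed.

(* For generic [y0] and [t], the two segments through [(t, y0)] avoid [X]: a point
   of [X] off [p] excludes at most one [t] for the segment starting at [p]. *)
Lemma avoiding_point (X : set (pt R)) p q : udisc R p -> udisc R q -> ~ X p -> ~ X q ->
  (forall K, compact K -> K `<=` udisc R -> finite_set (X `&` K)) ->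
  exists m, [/\ segment p m `<=` udisc R, segment m q `<=` udisc R,
    segment p m `&` X = set0 & segment m q `&` X = set0].
Proof.
move=> pD qD Xp Xq Xfin.
(* The bound [1 / 4] leaves room for [m], whose coordinates are chosen in [(0, 1 / 4)]. *)
have [r [pr qr r4 r1]] : exists r, [/\ dotp p p <= r, dotp q q <= r, 1/4 <= r & r < 1 :> R].
  exists (Num.max (1/4) (Num.max (dotp p p) (dotp q q))).
  by rewrite !le_max !lexx !orbT gt_max gt_max pD qD; split=> //; lra.
pose K := [set z : pt R | dotp z z <= r].
have Kdisc : K `<=` udisc R by move=> z /= zr; apply: le_lt_trans r1.
have {}Xfin := Xfin K (@compact_disc R r) Kdisc.
have [|y0 [y0l y0r y0p y0q]] := @exists_between_avoiding R 0 (1/4) p.2 q.2; first lra.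
(* The abscissa at height [y0] of the line through [a] and [x]. *)
pose bad a (x : pt R) := a.1 + (x.1 - a.1) * (y0 - a.2) / (x.2 - a.2).
have badfin : finite_set (bad p @` (X `&` K) `|` bad q @` (X `&` K)).
  by rewrite finite_setU; split; exact: finite_image.
have [|t [t0 t4 tbad]] := @finite_set_avoid _ 0 (1/4) badfin; first lra.
pose m : pt R := (t, y0).
have mr : dotp m m <= r by rewrite /dotp /=; nra.
have avoid a x u : ~ X a -> y0 <> a.2 -> X x -> K x -> x = segment_point a m u -> bad a x = t.
  move=> Xa y0a Xx Kx xE.
  have u0 : u != 0.
    apply/eqP => u0; apply: Xa; move: Xx; rewrite xE u0 /segment_point.
    by rewrite subr0 !mul1r !mul0r !addr0 -surjective_pairing.
  have ya : y0 - a.2 != 0 by rewrite subr_eq0; exact/eqP.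
  rewrite /bad xE /segment_point /=.
  have -> : (1 - u) * a.1 + u * t - a.1 = u * (t - a.1) by ring.
  have -> : (1 - u) * a.2 + u * y0 - a.2 = u * (y0 - a.2) by ring.
  by field; rewrite ya u0.
have pmK := segment_ball pr mr; have mqK := segment_ball mr qr.
exists m; split; [by move=> z /pmK /Kdisc|by move=> z /mqK /Kdisc| |].
  rewrite -subset0 => x [xs Xx]; have Kx := pmK _ xs; case: xs => u _ xE.
  by apply: tbad; left; exists x => //; exact: (avoid p x u).
rewrite -subset0 => x [xs Xx]; have Kx := mqK _ xs; case: xs => u _ xE.
apply: tbad; right; exists x => //; apply: (avoid q x (1 - u)) => //.
by rewrite -xE /segment_point; congr (_, _); ring.
Qed.

End PlaneTopology.

(** * Sides of cells as arcs *)

Section Cells.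
Variable R : realType.
Implicit Types (p q : pt R) (f g : pt R -> pt R).

Lemma segment_point_inj p q : p <> q -> injective (segment_point p q).
Proof.
move=> pq t u [e1 e2]; apply/eqP/negPn/negP => tu; apply: pq.
have tu0 : t - u != 0 by rewrite subr_eq0.
rewrite [p]surjective_pairing [q]surjective_pairing; congr (_, _).
  by apply: (mulfI tu0); lra.
by apply: (mulfI tu0); lra.
Qed.

Lemma segmentC p q : segment p q = segment q p.
Proof.
suff H (x y : pt R) : segment x y `<=` segment y x by rewrite eqEsubset; split; exact: H.
move=> _ [t /= + <-]; rewrite in_itv /= => /andP[t0 t1]; exists (1 - t).
  by rewrite /= in_itv /=; lra.
by rewrite /segment_point; congr (_, _); ring.
Qed.

(* An end point of an arc does not disconnect it, whereas every other point does. *)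
Lemma arc_endpoint f g p q p' q' : p <> q -> p' <> q' ->
  segment p q `<=` csquare (R := R) -> segment p' q' `<=` csquare (R := R) ->
  {within csquare (R := R), continuous f} -> {in csquare (R := R) &, injective f} ->
  {within csquare (R := R), continuous g} -> {in csquare (R := R) &, injective g} ->
  f @` segment p q = g @` segment p' q' -> f p = g p' \/ f p = g q'.
Proof.
move=> pq pq' sub sub' fc finj gc ginj fgE.
have {}finj x y : segment p q x -> segment p q y -> f x = f y -> x = y.
  by move=> /sub xs /sub ys; apply: finj; rewrite inE.
have {}ginj x y : segment p' q' x -> segment p' q' y -> g x = g y -> x = y.
  by move=> /sub' xs /sub' ys; apply: ginj; rewrite inE.
have : (g @` segment p' q') (f p) by rewrite -fgE; exists p => //; exact: segment_l.
move=> [_ [t /= + <-] gt]; rewrite in_itv /= => /andP[t0 t1].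
have s0 p1 q1 : segment_point p1 q1 0 = p1.
  by rewrite /segment_point subr0 !mul1r !mul0r !addr0 -surjective_pairing.
have s1 p1 q1 : segment_point p1 q1 1 = q1.
  by rewrite /segment_point subrr !mul1r !mul0r !add0r -surjective_pairing.
have [t00|tn0] := eqVneq t 0; first by left; rewrite -gt t00 s0.
have [t11|tn1] := eqVneq t 1; first by right; rewrite -gt t11 s1.
have {t0 tn0}t0 : 0 < t by rewrite lt_def tn0.
have {t1 tn1}t1 : t < 1 by rewrite lt_def eq_sym tn1.
have seg p1 q1 u : 0 <= u -> u <= 1 -> segment p1 q1 (segment_point p1 q1 u).
  by move=> u0 u1; exists u => //=; rewrite in_itv /= u0.
(* The arc without [f p]. If [f p] were an inner point [g t], the closed pieces [A] and [B] of the
   arc before and after it would meet only there. Being connected, [E] would lie in [A], although it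
   contains [g q']. *)
pose E := f @` (segment_point p q @` `]0, 1]%classic).
have Ef x : (f @` segment p q) x -> x <> f p -> E x.
  move=> [_ [u /= + <-] <-] xn; rewrite in_itv /= => /andP[u0 u1].
  exists (segment_point p q u) => //; exists u => //=; rewrite in_itv /= u1 andbT.
  by rewrite lt_def u0 andbT; apply/eqP => u00; apply: xn; rewrite u00 s0.
have Ecomp : E `<=` f @` segment p q /\ ~ E (f p).
  split=> [_ [_ [u /= + <-] <-]|[_ [u /= + <-]]]; rewrite in_itv /= => /andP[u0 u1].
    by exists (segment_point p q u) => //; apply: seg => //; exact: ltW.
  move/finj => H; have := H (seg _ _ _ (ltW u0) u1) (segment_l p q).
  rewrite -[p in RHS](s0 p q) => /(segment_point_inj pq) u00.
  by rewrite u00 ltxx in u0.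
have [Esub Efp] := Ecomp.
have Econ : connected E.
  apply: connected_continuous_connected.
    apply: connected_continuous_connected.
      by apply/connected_intervalP; exact: interval_is_interval.
    by apply: continuous_subspaceT; exact: segment_point_continuous.
  apply: continuous_subspaceW fc => _ [u /= + <-]; rewrite in_itv /= => /andP[u0 u1].
  by apply: sub; apply: seg => //; exact: ltW.
have arc_closed a b : 0 <= a -> b <= 1 ->
    closed (g @` (segment_point p' q' @` `[a, b]%classic)).
  move=> a0 b1; apply: plane_compact_closed; apply: continuous_compact.
    apply: continuous_subspaceW gc => _ [u /= + <-]; rewrite in_itv /= => /andP[u0 u1].
    by apply: sub'; apply: seg; [exact: le_trans u0|exact: le_trans b1].
  apply: continuous_compact; last exact: segment_compact.
  by apply: continuous_subspaceT; exact: segment_point_continuous.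
pose A := g @` (segment_point p' q' @` `[0, t]%classic).
pose B := g @` (segment_point p' q' @` `[t, 1]%classic).
have EA : E `<=` A.
  apply: (@connected_two_closed _ E A B) => //.
  - by apply: arc_closed => //; exact: ltW.
  - by apply: arc_closed => //; exact: ltW.
  - move=> x /Esub; rewrite fgE => -[_ [u /= + <-] <-]; rewrite in_itv /= => /andP[u0 u1].
    have [ut|tu] := leP u t; [left|right];
      by exists (segment_point p' q' u) => //; exists u => //=; rewrite in_itv /= ?u0 ?u1 ?ut ?(ltW tu).
  - rewrite -subset0 => x [[Ex [_ [u /= + <-] gu]] [_ [w /= + <-] gw]].
    rewrite !in_itv /= => /andP[u0 ut] /andP[tw w1].
    have /(segment_point_inj pq') uw : segment_point p' q' u = segment_point p' q' w.
      by apply: ginj; [apply: seg => //; lra|apply: seg => //; lra|rewrite gu gw].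
    have ut' : u = t by lra.
    by apply: Efp; rewrite -gt -ut' gu.
  exists (g p'); split; last first.
    by exists p' => //; exists 0; rewrite ?s0//= in_itv /= lexx ltW.
  apply: Ef; first by rewrite fgE; exists p' => //; exact: segment_l.
  rewrite -gt -{1}(s0 p' q') => /ginj H.
  have /(segment_point_inj pq') tt : segment_point p' q' 0 = segment_point p' q' t.
    by apply: H; apply: seg; rewrite ?lexx ?ler01 ?(ltW t0) ?(ltW t1).
  by rewrite -tt ltxx in t0.
have : A (g q').
  apply: EA; apply: Ef; first by rewrite fgE; exists q' => //; exact: segment_r.
  rewrite -gt -{1}(s1 p' q') => /ginj H.
  have /(segment_point_inj pq') tt : segment_point p' q' 1 = segment_point p' q' t.
    by apply: H; apply: seg; rewrite ?lexx ?ler01 ?(ltW t0) ?(ltW t1).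
  by rewrite -tt ltxx in t1.
move=> [_ [u /= + <-]]; rewrite in_itv /= => /andP[u0 ut].
rewrite -[q' in RHS](s1 p' q') => /ginj H.
have /(segment_point_inj pq') u1 : segment_point p' q' u = segment_point p' q' 1.
  by apply: H; apply: seg => //; rewrite ?ler01//; lra.
by move: ut; rewrite u1 leNgt t1.
Qed.

End Cells.

Section FaceConnectivity.
Variables (R : realType) (Q : quad_graph R).
Hypothesis disc : bquad_graph_of_disc Q.
Local Notation fv := (qfv Q).
Local Notation cell := (qcell Q).

Definition share_edge e e' := exists i j i' j',
  [/\ qwhite Q (fv e i), ~~ qwhite Q (fv e j), fv e i = fv e' i' & fv e j = fv e' j'].

Lemma side_segment i : side i = segment (corner R i) (corner R (nxt i)).
Proof.
rewrite eqEsubset; split=> [x [t t01 ->]|_ [t /= + <-]].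
  by exists t => //=; rewrite in_itv.
by rewrite in_itv => t01; exists t.
Qed.

Lemma segment_csquare i j : segment (corner R i) (corner R j) `<=` csquare (R := R).
Proof.
move=> _ [t /= + <-]; rewrite in_itv /= => /andP[t0 t1].
have [/andP[a b] /andP[c d]] := corner_csquare R i.
have [/andP[a' b'] /andP[c' d']] := corner_csquare R j.
by split; apply/andP; split => /=; nra.
Qed.

Lemma face_closed e : closed (face_set (Q := Q) e).
Proof.
have [_ [cellP _]] := disc; have [cc _] := cellP e.
apply: plane_compact_closed; apply: continuous_compact => //.
have -> : csquare (R := R) = `[0, 1]%classic `*` `[0, 1]%classic.
  by rewrite eqEsubset; split=> x [x1 x2]; split; rewrite /= ?in_itv //= ; move: x1 x2; rewrite /= !in_itv.
by apply: compact_setX; exact: segment_compact.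
Qed.

Lemma nxt_neq i : i <> nxt i.
Proof. by move: i; apply: ord4P; rewrite nxtE => /(congr1 val); rewrite /= ?inordK. Qed.

(** The two parametrisations of a common side are unrelated, but [arc_endpoint] matches their end
    points. Of these, one is white and one black. *)
Lemma share_side_edge e e' i j : cell e @` side i = cell e' @` side j -> share_edge e e'.
Proof.
have [colors [cellP [cornerE [[pos_inj _] _]]]] := disc.
have [cc ci] := cellP e; have [cc' ci'] := cellP e'.
have cneq k : corner R k <> corner R (nxt k) by move/(@corner_inj R); exact: nxt_neq.
rewrite !side_segment => E.
have Pi : fv e i = fv e' j \/ fv e i = fv e' (nxt j).
  have := arc_endpoint (cneq i) (cneq j) (@segment_csquare _ _) (@segment_csquare _ _) cc ci cc' ci' E.
  by rewrite !cornerE => -[/pos_inj|/pos_inj]; [left|right].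
have Pn : fv e (nxt i) = fv e' j \/ fv e (nxt i) = fv e' (nxt j).
  rewrite segmentC in E.
  have := arc_endpoint (not_eq_sym (cneq i)) (cneq j) (@segment_csquare _ _) (@segment_csquare _ _) cc ci cc' ci' E.
  by rewrite !cornerE => -[/pos_inj|/pos_inj]; [left|right].
have [k kE] : exists k, fv e i = fv e' k by case: Pi => ->; eexists.
have [l lE] : exists l, fv e (nxt i) = fv e' l by case: Pn => ->; eexists.
have wn := white_nxt colors e i; case: (boolP (qwhite Q (fv e i))) => wi.
  by exists i, (nxt i), k, l; rewrite wn wi.
by exists (nxt i), i, l, k; rewrite wn wi.
Qed.

Lemma center_not_side (i : 'I_4) : ~ side i (1 / 2 : R, 1 / 2 : R).
Proof.
by move: i; apply: ord4P; rewrite /side /corner nxtE /= ?inordK//= => -[t _ [e1 e2]]; lra.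
Qed.

(** A face with [P] and a face without it meet at most in a vertex. Two segments avoiding the
    vertices lead from the centre of [e0] to that of [e]. The finitely many faces along each segment
    form two closed sets, with and without [P], disjoint on the segment; connectedness carries [P]
    along. *)
Lemma face_connected (P : qF Q -> Prop) e0 : P e0 ->
  (forall e e', P e -> share_edge e e' -> P e') -> forall e, P e.
Proof.
have [colors [cellP [cornerE [[pos_inj vface] [cover [fint [fmeet [_ ffin]]]]]]]] := disc.
move=> P0 Pshare e; apply: contrapT => nPe.
pose X := [set z : pt R | exists v, qpos Q v = z].
have meetX f g x : P f -> ~ P g -> face_set (Q := Q) f x -> face_set (Q := Q) g x -> X x.
  move=> Pf nPg fx gx; have fg : f <> g by move=> fg; apply: nPg; rewrite -fg.
  have xI : (face_set (Q := Q) f `&` face_set (Q := Q) g) x by [].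
  have [I0|[i [j [_ IE]]]|[i [j [IE IE']]]] := fmeet f g fg.
  - by rewrite I0 in xI.
  - by rewrite IE in xI; exists (fv f i); rewrite xI.
  - by case: nPg; apply: (Pshare f) => //; apply: (@share_side_edge f g i j); rewrite -IE -IE'.
have facesD f x : face_set (Q := Q) f x -> udisc R x by move=> fx; rewrite -cover; exists f.
have step S : connected S -> compact S -> S `<=` udisc R -> S `&` X = set0 ->
    (exists2 x, S x & exists2 f, P f & face_set (Q := Q) f x) ->
    forall x, S x -> exists2 f, P f & face_set (Q := Q) f x.
  move=> cS kS SD SX [x0 Sx0 [f0 Pf0 fx0]].
  pose Fin := [set f | (face_set (Q := Q) f `&` S) !=set0].
  have Ffin : finite_set Fin := ffin S kS SD.
  pose A := \bigcup_(f in Fin `&` [set f | P f]) face_set (Q := Q) f.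
  pose B := \bigcup_(f in Fin `&` [set f | ~ P f]) face_set (Q := Q) f.
  suff SA : S `<=` A by move=> x /SA[f [_ Pf] fx]; exists f.
  apply: (@connected_two_closed _ S A B) => //.
  - apply: (@closed_bigcup _ {classic (qF Q)}); first exact: finite_setIl.
    by move=> f _; exact: face_closed.
  - apply: (@closed_bigcup _ {classic (qF Q)}); first exact: finite_setIl.
    by move=> f _; exact: face_closed.
  - move=> x Sx; have : udisc R x := SD x Sx.
    rewrite -cover => -[f _ fx]; have Ff : Fin f by exists x.
    by have [Pf|nPf] := pselect (P f); [left|right]; exists f.
  - rewrite -subset0 => x [[Sx [f [_ Pf] fx]] [g [_ nPg] gx]].
    have : (S `&` X) x by split=> //; exact: (meetX f g).
    by rewrite SX.
  exists x0; split=> //; exists f0 => //; split=> //.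
  by exists x0.
pose mid : pt R := (1 / 2, 1 / 2).
have midc : csquare mid by split; rewrite /mid /=; lra.
have mido : osquare mid by split; rewrite /mid /=; lra.
have midcorner i : mid <> corner R i.
  by move: i; apply: ord4P; rewrite /mid /corner /= ?inordK//= => -[]; lra.
have midside i : ~ side i mid by exact: center_not_side.
have midX f : ~ X (cell f mid).
  move=> [v vE]; have [g [j gj]] := vface v; rewrite -gj -cornerE in vE.
  have [_ finj] := cellP f; have cs i : corner R i \in csquare (R := R) by rewrite inE; exact: corner_csquare.
  have ms : mid \in csquare (R := R) by rewrite inE.
  have [fg|fg] := pselect (f = g).
    by rewrite -fg in vE; apply: (midcorner j); apply/esym; exact: finj vE.
  have xI : (face_set (Q := Q) f `&` face_set (Q := Q) g) (cell f mid).
    by split; [exists mid|exists (corner R j) => //; exact: corner_csquare].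
  have [I0|[i [_ [_ IE]]]|[i [_ [IE _]]]] := fmeet f g fg.
  - by rewrite I0 in xI.
  - rewrite IE /= -cornerE in xI; exact: (midcorner i (finj _ _ ms (cs i) xI)).
  - rewrite IE in xI; case: xI => y yi yE; apply: (midside i).
    suff -> : mid = y by [].
    by apply: finj => //; rewrite inE; move: yi; rewrite side_segment; exact: segment_csquare.
have pD f : udisc R (cell f mid) by apply: (facesD f); exists mid.
have Xfin K : compact K -> K `<=` udisc R -> finite_set (X `&` K).
  move=> kK KD; have Ffin := ffin K kK KD.
  have : finite_set ((fun fi : qF Q * 'I_4 => qpos Q (fv fi.1 fi.2)) @`
      ([set f | (face_set (Q := Q) f `&` K) !=set0] `*` setT)).
    by apply: finite_image; apply: finite_setX.
  apply: sub_finite_set => x [[v vE] Kx]; have [g [j gj]] := vface v.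
  exists (g, j) => /=; last by rewrite gj.
  split=> //=; exists x; split=> //; exists (corner R j); first exact: corner_csquare.
  by rewrite cornerE gj.
have [m [pm mq pmX mqX]] := avoiding_point (pD e0) (pD e) (midX e0) (midX e) Xfin.
have [f1 Pf1 mf1] : exists2 f, P f & face_set (Q := Q) f m.
  apply: (step _ (@connected_segment _ _ _) (@compact_segment _ _ _) pm pmX) (segment_r _ _).
  by exists (cell e0 mid); [exact: segment_l|exists e0 => //; exists mid].
have [f2 Pf2 ef2] : exists2 f, P f & face_set (Q := Q) f (cell e mid).
  apply: (step _ (@connected_segment _ _ _) (@compact_segment _ _ _) mq mqX) (segment_r _ _).
  by exists m; [exact: segment_l|exists f1].
by apply: (midX e); apply: (meetX f2 e) => //; exists mid.
Qed.

End FaceConnectivity.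

(** * Hyperboloid model and layout *)

Section Lorentz.
Variable R : realType.
Local Notation vec := ((pt R * R)%type).
Implicit Types (p q w x y z u n : vec) (a b c : R).

Definition lor x y : R := x.1.1 * y.1.1 + x.1.2 * y.1.2 - x.2 * y.2.

Definition det3 x y z : R :=
  x.1.1 * (y.1.2 * z.2 - y.2 * z.1.2) - x.1.2 * (y.1.1 * z.2 - y.2 * z.1.1)
  + x.2 * (y.1.1 * z.1.2 - y.1.2 * z.1.1).

Definition comb a b c p q w : vec :=
  ((a * p.1.1 + b * q.1.1 + c * w.1.1, a * p.1.2 + b * q.1.2 + c * w.1.2),
   a * p.2 + b * q.2 + c * w.2).

Lemma vec_eq x y : x.1.1 = y.1.1 -> x.1.2 = y.1.2 -> x.2 = y.2 -> x = y.
Proof. by case: x => [[? ?] ?]; case: y => [[? ?] ?] /= -> -> ->. Qed.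

Lemma lorC x y : lor x y = lor y x.
Proof. by rewrite /lor; ring. Qed.

Lemma comb_cramer p q w x : det3 p q w != 0 ->
  x = comb (det3 x q w / det3 p q w) (det3 p x w / det3 p q w) (det3 p q x / det3 p q w) p q w.
Proof.
move=> D0; have cramer a b c (r s t u : R) : det3 p q w * u = a * r + b * s + c * t ->
    u = a / det3 p q w * r + b / det3 p q w * s + c / det3 p q w * t.
  by move=> E; apply: (mulfI D0); rewrite E; field.
by apply: vec_eq; apply: cramer; rewrite /det3; ring.
Qed.

Lemma lor_comb a b c a' b' c' p q w :
  lor (comb a b c p q w) (comb a' b' c' p q w) =
  a * a' * lor p p + b * b' * lor q q + c * c' * lor w w + (a * b' + b * a') * lor p q
  + (a * c' + c * a') * lor p w + (b * c' + c * b') * lor q w.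
Proof. by rewrite /lor /comb /=; ring. Qed.

Lemma det3_comb a b c a' b' c' a2 b2 c2 p q w :
  det3 (comb a b c p q w) (comb a' b' c' p q w) (comb a2 b2 c2 p q w) =
  det3 ((a, b), c) ((a', b'), c') ((a2, b2), c2) * det3 p q w.
Proof. by rewrite /det3 /comb /=; ring. Qed.

Definition basis_map p q w p' q' w' x : vec :=
  comb (det3 x q w / det3 p q w) (det3 p x w / det3 p q w) (det3 p q x / det3 p q w) p' q' w'.

Section BasisMap.
Variables p q w p' q' w' : vec.
Hypothesis D0 : det3 p q w != 0.
Let A := basis_map p q w p' q' w'.

Lemma basis_map1 : A p = p'.
Proof.
rewrite /A /basis_map divff// (_ : det3 p p w = 0) 1?(_ : det3 p q p = 0) ?mul0r;
  [|by rewrite /det3; ring..].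
by apply: vec_eq; rewrite /comb /=; ring.
Qed.

Lemma basis_map2 : A q = q'.
Proof.
rewrite /A /basis_map divff// (_ : det3 q q w = 0) 1?(_ : det3 p q q = 0) ?mul0r;
  [|by rewrite /det3; ring..].
by apply: vec_eq; rewrite /comb /=; ring.
Qed.

Lemma basis_map_det x y z :
  det3 (A x) (A y) (A z) * det3 p q w = det3 x y z * det3 p' q' w'.
Proof.
rewrite [in RHS](comb_cramer x D0) [in RHS](comb_cramer y D0) [in RHS](comb_cramer z D0).
by rewrite /A /basis_map !det3_comb; ring.
Qed.

Lemma basis_mapK : det3 p' q' w' != 0 -> cancel A (basis_map p' q' w' p q w).
Proof.
move=> D'0 x; rewrite [RHS](comb_cramer x D0) /A /basis_map.
set a := det3 x q w / _; set b := det3 p x w / _; set c := det3 p q x / _.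
congr comb; apply: (mulIf D'0); rewrite divfK// /det3 /comb /=; ring.
Qed.

Hypothesis gram_diag : [/\ lor p p = lor p' p', lor q q = lor q' q' & lor w w = lor w' w'].
Hypothesis gram_off : [/\ lor p q = lor p' q', lor p w = lor p' w' & lor q w = lor q' w'].

Lemma basis_map_lor x y : lor (A x) (A y) = lor x y.
Proof.
have [g1 g2 g3] := gram_diag; have [g4 g5 g6] := gram_off.
rewrite [in RHS](comb_cramer x D0) [in RHS](comb_cramer y D0).
by rewrite /A /basis_map !lor_comb g1 g2 g3 g4 g5 g6.
Qed.

End BasisMap.

(** The products with [p] and [q] fix the component in their plane, which is nondegenerate. The
    square of [det3 p q y] is minus a Gram determinant, so [lor y y] fixes the remaining component
    up to sign, and the last hypothesis fixes the sign. *)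
Lemma lor_unique p q y y' : lor p p * lor q q - lor p q ^+ 2 != 0 ->
  lor p y = lor p y' -> lor q y = lor q y' -> lor y y = lor y' y' ->
  0 < det3 p q y * det3 p q y' -> y = y'.
Proof.
set G := _ - _ => G0 py qy yy dd.
have det_sqr z : det3 p q z ^+ 2 = - (lor p p * (lor q q * lor z z - lor q z ^+ 2)
   - lor p q * (lor p q * lor z z - lor q z * lor p z)
   + lor p z * (lor p q * lor q z - lor q q * lor p z)).
  by rewrite /det3 /lor; ring.
have dE : det3 p q y = det3 p q y'.
  have : det3 p q y ^+ 2 = det3 p q y' ^+ 2 by rewrite !det_sqr py qy yy.
  move/eqP; rewrite eqf_sqr => /orP[/eqP//|/eqP dN].
  by move: dd; rewrite dN mulNr -expr2; have := sqr_ge0 (det3 p q y'); lra.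
(* The expansion of [G z] in [p], [q] and their Lorentz cross product, coordinate by coordinate. *)
pose co z := G * z.1.1 = (lor q q * lor p z - lor p q * lor q z) * p.1.1
   + (lor p p * lor q z - lor p q * lor p z) * q.1.1
   - det3 p q z * (p.1.2 * q.2 - p.2 * q.1.2).
pose co2 z := G * z.1.2 = (lor q q * lor p z - lor p q * lor q z) * p.1.2
   + (lor p p * lor q z - lor p q * lor p z) * q.1.2
   - det3 p q z * (p.2 * q.1.1 - p.1.1 * q.2).
pose co3 z := G * z.2 = (lor q q * lor p z - lor p q * lor q z) * p.2
   + (lor p p * lor q z - lor p q * lor p z) * q.2
   + det3 p q z * (p.1.1 * q.1.2 - p.1.2 * q.1.1).
have e1 z : co z by rewrite /co /G /det3 /lor; ring.
have e2 z : co2 z by rewrite /co2 /G /det3 /lor; ring.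
have e3 z : co3 z by rewrite /co3 /G /det3 /lor; ring.
apply: vec_eq; apply: (mulfI G0).
- by rewrite (e1 y) (e1 y') py qy dE.
- by rewrite (e2 y) (e2 y') py qy dE.
- by rewrite (e3 y) (e3 y') py qy dE.
Qed.

Definition hyperboloid : set vec := [set u | lor u u = -1 /\ 0 < u.2].

(** For timelike vectors Cauchy-Schwarz on the space parts shows that [u.2 * n.2] outweighs the rest
    and decides the sign of [lor u n]. *)
Lemma future_lor u n : lor u u < 0 -> lor n n < 0 -> 0 < n.2 -> (0 < u.2 <-> lor u n < 0).
Proof.
move=> uu nn n0.
have cs : (u.1.1 * n.1.1 + u.1.2 * n.1.2) ^+ 2 < (u.2 * n.2) ^+ 2.
  have h1 : 0 <= u.1.1 ^+ 2 + u.1.2 ^+ 2 by rewrite addr_ge0 ?sqr_ge0.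
  have h2 : u.1.1 ^+ 2 + u.1.2 ^+ 2 < u.2 ^+ 2 by move: uu; rewrite /lor; lra.
  have h3 : n.1.1 ^+ 2 + n.1.2 ^+ 2 < n.2 ^+ 2 by move: nn; rewrite /lor; lra.
  have h4 : 0 <= (u.1.1 * n.1.2 - u.1.2 * n.1.1) ^+ 2 by rewrite sqr_ge0.
  have h5 : 0 < n.2 ^+ 2 by rewrite exprn_gt0.
  have h6 : (u.1.1 ^+ 2 + u.1.2 ^+ 2) * (n.1.1 ^+ 2 + n.1.2 ^+ 2) <=
     (u.1.1 ^+ 2 + u.1.2 ^+ 2) * n.2 ^+ 2 by rewrite ler_wpM2l// ltW.
  have h7 : (u.1.1 ^+ 2 + u.1.2 ^+ 2) * n.2 ^+ 2 < u.2 ^+ 2 * n.2 ^+ 2 by rewrite ltr_pM2r.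
  by rewrite exprMn; lra.
move: cs; rewrite /lor; set s := _ + _; set t := u.2 * n.2 => cs.
split=> [u0|st].
  have t0 : 0 < t by rewrite mulr_gt0.
  by nra.
rewrite -(pmulr_lgt0 _ n0) -/t ltNge; apply/negP => t0; nra.
Qed.

(** The inverse of the stereographic projection [proj_pt] of the hyperboloid from [(0, 0, -1)]. *)
Definition lift_pt (z : pt R) : vec :=
  ((2 * z.1 / (1 - dotp z z), 2 * z.2 / (1 - dotp z z)), (1 + dotp z z) / (1 - dotp z z)).

Definition proj_pt u : pt R := (u.1.1 / (1 + u.2), u.1.2 / (1 + u.2)).

Lemma udisc_denom (z : pt R) : udisc R z -> 1 - dotp z z != 0.
Proof. by rewrite /udisc /= => z1; rewrite gt_eqF// subr_gt0. Qed.

Lemma lift_hyperboloid (z : pt R) : udisc R z -> hyperboloid (lift_pt z).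
Proof.
move=> zD; have d0 := udisc_denom zD; rewrite /hyperboloid /lift_pt /lor /=; split.
  by move: d0; rewrite /dotp => d0; field.
by rewrite divr_gt0 ?subr_gt0//; have := dotp_ge0 z; lra.
Qed.

Lemma lift_ptK (z : pt R) : udisc R z -> proj_pt (lift_pt z) = z.
Proof.
move=> zD; have d0 := udisc_denom zD; rewrite /proj_pt /lift_pt /=.
rewrite [RHS]surjective_pairing; congr (_, _); move: d0; set D := dotp z z => d0; field;
  by rewrite d0 (_ : 1 - D + (1 + D) = 2) ?pnatr_eq0//; ring.
Qed.

Lemma proj_hyperboloid u : hyperboloid u -> udisc R (proj_pt u) /\ lift_pt (proj_pt u) = u.
Proof.
rewrite /hyperboloid /lor /= => -[uu u0].
have t0 : 0 < 1 + u.2 by lra.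
have t00 : 1 + u.2 != 0 by rewrite gt_eqF.
have dE : dotp (proj_pt u) (proj_pt u) = (u.2 - 1) / (1 + u.2).
  apply: (mulIf (mulf_neq0 t00 t00)); rewrite /dotp /proj_pt /=.
  transitivity (u.1.1 ^+ 2 + u.1.2 ^+ 2); first by field.
  have -> : u.1.1 ^+ 2 + u.1.2 ^+ 2 = u.2 ^+ 2 - 1 by lra.
  by field.
split; first by rewrite /udisc /= dE ltr_pdivrMr// mul1r; lra.
by apply: vec_eq; rewrite /lift_pt dE /proj_pt /=; field; rewrite t00 /=;
  rewrite (_ : _ - (u.2 - 1) = 2) ?pnatr_eq0//; ring.
Qed.

Lemma hdist_lor (z w : pt R) : udisc R z -> udisc R w -> hdist z w = acosh (- lor (lift_pt z) (lift_pt w)).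
Proof.
move=> /udisc_denom z0 /udisc_denom w0; rewrite /hdist; congr acosh.
by rewrite /lor /lift_pt /vsub /=; move: z0 w0; rewrite /dotp /= => z0 w0; field; rewrite z0 w0.
Qed.

(** For a circle in the disc this is [sqrt (kappa ^ 2 - 1)] times the lift of its hyperbolic centre;
    with this factor the products below are polynomials in the curvatures. *)
Definition circle_vec (c : pt R) (r : R) : vec :=
  ((c.1 / r, c.2 / r), (1 + dotp c c - r ^+ 2) / (2 * r)).

Lemma lor_circle (c : pt R) (r : R) : 0 < r -> lor (circle_vec c r) (circle_vec c r) = 1 - kappa c r ^+ 2.
Proof.
by move=> r0; rewrite /lor /circle_vec /kappa /dotp /=; field; rewrite gt_eqF.
Qed.

Lemma lor_circle_lift (c : pt R) (r : R) (z : pt R) : 0 < r -> udisc R z ->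
  edist z c = r <-> lor (circle_vec c r) (lift_pt z) = - kappa c r.
Proof.
move=> r0 /udisc_denom d0; have r00 : r != 0 by rewrite gt_eqF.
have E : lor (circle_vec c r) (lift_pt z) = - kappa c r
    + (r ^+ 2 - edist z c ^+ 2) / (r * (1 - dotp z z)).
  rewrite edist_sqr /lor /circle_vec /lift_pt /kappa /=; move: d0; rewrite /dotp => d0.
  by field; rewrite r00 d0.
rewrite E; split=> [->|/eqP]; first by rewrite subrr mul0r addr0.
rewrite -subr_eq0 opprK addrAC addNr add0r mulf_eq0 invr_eq0 mulf_eq0 (negPf r00) (negPf d0) !orbF.
rewrite subr_eq0 => /eqP H; apply/eqP; rewrite -(@eqrXn2 _ 2) ?enorm_ge0 ?ltW//; exact/eqP/esym.
Qed.

Lemma lor_circles (c : pt R) (r : R) (c' : pt R) (r' a : R) : 0 < r -> 0 < r' ->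
  dotp (vsub c' c) (vsub c' c) = r ^+ 2 + r' ^+ 2 - 2 * r * r' * a ->
  lor (circle_vec c r) (circle_vec c' r') = - (kappa c r * kappa c' r' - a).
Proof.
move=> r0 r'0 d; have rr : 4 * (r * r') != 0 by rewrite gt_eqF// mulr_gt0// mulr_gt0.
apply: (mulfI rr).
transitivity (2 * (2 * (c.1 * c'.1 + c.2 * c'.2)) - (1 + dotp c c - r ^+ 2) * (1 + dotp c' c' - r' ^+ 2)).
  by rewrite /lor /circle_vec /=; field; rewrite !gt_eqF.
have -> : 2 * (c.1 * c'.1 + c.2 * c'.2) = dotp c c + dotp c' c' - (r ^+ 2 + r' ^+ 2 - 2 * r * r' * a).
  by rewrite -d /dotp /vsub /=; ring.
by rewrite /kappa; field; rewrite !gt_eqF.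
Qed.

(** This carries the Euclidean orientation of a kite over to the vectors. *)
Lemma det3_kite (c : pt R) (r : R) (b c' : pt R) (r' : R) : 0 < r -> 0 < r' -> udisc R b -> edist b c = r -> edist b c' = r' ->
  det3 (circle_vec c r) (lift_pt b) (circle_vec c' r') = detp (vsub b c) (vsub c' c) / (r * r').
Proof.
move=> r0 r'0 /udisc_denom d0 bc bc'.
have e : dotp c c - r ^+ 2 = 2 * (b.1 * c.1 + b.2 * c.2) - dotp b b.
  by rewrite -bc edist_sqr /dotp; ring.
have e' : dotp c' c' - r' ^+ 2 = 2 * (b.1 * c'.1 + b.2 * c'.2) - dotp b b.
  by rewrite -bc' edist_sqr /dotp; ring.
rewrite /circle_vec -![1 + _ - _]addrA e e' /det3 /lift_pt /detp /vsub /=.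
move: d0; rewrite /dotp => d0; field; rewrite d0 !gt_eqF//.
Qed.

End Lorentz.

(** * The isometry between the two patterns *)

Section Layout.
Variables (R : realType) (Q : quad_graph R) (alpha : qF Q -> R).
Hypothesis disc : bquad_graph_of_disc Q.
Hypothesis adm : admissible alpha.
Local Notation fv := (qfv Q).
Local Notation white := (qwhite Q).

Let colors : forall f, [/\ qwhite Q (qfv Q f 0), ~~ qwhite Q (qfv Q f 1),
  qwhite Q (qfv Q f (inord 2)) & ~~ qwhite Q (qfv Q f (inord 3))].
Proof. by case: disc. Qed.

Let alpha_bounds : forall e, 0 < alpha e < pi.
Proof. by case: adm. Qed.

Definition vertex_vec (C : cpattern Q) v :=
  if white v then circle_vec (cen C v) (rad C v) else lift_pt (ipt C v).

Definition kap (C : cpattern Q) v := kappa (cen C v) (rad C v).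

Lemma opposite i j e : white (fv e i) -> ~~ white (fv e j) -> j = nxt i \/ j = nxt (nxt (nxt i)).
Proof.
have [c0 c1 c2 c3] := colors e.
by move: i; apply: ord4P; move: j; apply: ord4P; rewrite ?(negPf c1) ?(negPf c3) ?c0 ?c2 ?nxtE; auto.
Qed.

Lemma nxt4 i : nxt (nxt (nxt (nxt i))) = i.
Proof. by move: i; apply: ord4P; rewrite !nxtE. Qed.

Section OnePattern.
Variable C : cpattern Q.
Hypothesis (pat : circle_pattern C alpha) (sub : contained_in_disc C).

Lemma ipt_udisc e i j : white (fv e i) -> ~~ white (fv e j) -> udisc R (ipt C (fv e j)).
Proof. by move=> wi bj; apply: (sub wi); exact: (ipt_edist pat). Qed.

Lemma kap_gt1 v : white v -> 1 < kap C v.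
Proof. by move=> wv; have [] := kappa_inside (rad_gt0 pat wv) (circle_inside pat sub wv). Qed.

Lemma lor_white v : white v -> lor (vertex_vec C v) (vertex_vec C v) = 1 - kap C v ^+ 2.
Proof. by move=> wv; rewrite /vertex_vec wv lor_circle// (rad_gt0 pat wv). Qed.

Lemma white_future v : white v -> 0 < (vertex_vec C v).2.
Proof.
move=> wv; have r0 := rad_gt0 pat wv; have ins := circle_inside pat sub wv.
have c0 := enorm_ge0 (cen C v); have c2 := enorm_sqr (cen C v).
by rewrite /vertex_vec wv /= divr_gt0 ?mulr_gt0// -c2; nra.
Qed.

Lemma lor_black e j : ~~ white (fv e j) -> lor (vertex_vec C (fv e j)) (vertex_vec C (fv e j)) = -1.
Proof.
move=> bj; rewrite /vertex_vec (negPf bj); have [c0 _ _ _] := colors e.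
by have [] := lift_hyperboloid (ipt_udisc c0 bj).
Qed.

Lemma lor_white_black e i j : white (fv e i) -> ~~ white (fv e j) ->
  lor (vertex_vec C (fv e i)) (vertex_vec C (fv e j)) = - kap C (fv e i).
Proof.
move=> wi bj; rewrite /vertex_vec wi (negPf bj).
apply: (lor_circle_lift _ (rad_gt0 pat wi) (ipt_udisc wi bj)).1; exact: (ipt_edist pat).
Qed.

Lemma lor_white_white e i : white (fv e i) ->
  lor (vertex_vec C (fv e i)) (vertex_vec C (fv e (nxt (nxt i)))) =
  - (kap C (fv e i) * kap C (fv e (nxt (nxt i))) - cos (alpha e)).
Proof.
move=> wi; have wn : white (fv e (nxt (nxt i))) by rewrite !(white_nxt colors) negbK.
rewrite /vertex_vec wi wn; apply: lor_circles; [exact: (rad_gt0 pat wi)|exact: (rad_gt0 pat wn)|].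
exact: white_dist.
Qed.

Lemma corner_det3 s e i : s = 1 \/ s = -1 ->
  (forall e, 0 < s * detp (vsub (ipt C (fv e 1)) (cen C (fv e 0)))
               (vsub (cen C (fv e (inord 2))) (cen C (fv e 0)))) -> white (fv e i) ->
  0 < s * det3 (vertex_vec C (fv e i)) (vertex_vec C (fv e (nxt i)))
               (vertex_vec C (fv e (nxt (nxt i)))).
Proof.
move=> s1 orient wi; have wn : white (fv e (nxt (nxt i))) by rewrite !(white_nxt colors) negbK.
have bn : ~~ white (fv e (nxt i)) by rewrite (white_nxt colors) negbK.
have r0 := rad_gt0 pat wi; have r0' := rad_gt0 pat wn.
rewrite /vertex_vec wi wn (negPf bn).
rewrite (det3_kite r0 r0' (ipt_udisc wi bn) (ipt_edist pat wi bn) (ipt_edist pat wn bn)).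
by rewrite mulrA; apply: divr_gt0; [exact: (corner_orient colors pat orient wi)|rewrite mulr_gt0].
Qed.

End OnePattern.

Section TwoPatterns.
Variables C Ct : cpattern Q.
Hypothesis (pat : circle_pattern C alpha) (sub : contained_in_disc C).
Hypothesis (patt : circle_pattern Ct alpha) (subt : contained_in_disc Ct).
Hypothesis kapE : forall v, white v -> kap C v = kap Ct v.

Local Notation P := (vertex_vec C).
Local Notation P' := (vertex_vec Ct).

Lemma face_gram e i j : white (fv e i) || (i == j) ->
  lor (P (fv e i)) (P (fv e j)) = lor (P' (fv e i)) (P' (fv e j)).
Proof.
have [c0 c1 c2 c3] := colors e.
case: (boolP (white (fv e i))) => [wi _|bi /= /eqP <-]; last by rewrite !lor_black.
case: (boolP (white (fv e j))) => wj; last by rewrite !lor_white_black// kapE.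
have [->|->] : j = i \/ j = nxt (nxt i).
- move: wi wj; move: i j; apply: ord4P; apply: ord4P;
    by rewrite ?nxtE ?(negPf c1) ?(negPf c3) //; auto.
- by rewrite !lor_white// kapE.
have wn : white (fv e (nxt (nxt i))) by rewrite !(white_nxt colors) negbK.
by rewrite !lor_white_white// !kapE.
Qed.

Lemma face_indices e i j l : white (fv e i) -> ~~ white (fv e j) ->
  [\/ l = i, l = nxt (nxt i), l = j | l = nxt (nxt j)].
Proof.
move=> wi bj.
have [->|->] := opposite wi bj; rewrite ?nxt4;
move: i l {wi bj}; apply: ord4P; apply: ord4P; rewrite !nxtE;
  by [constructor|constructor 2|constructor 3|constructor 4].
Qed.

Variables s s' : R.
Hypothesis s1 : s = 1 \/ s = -1.
Hypothesis s'1 : s' = 1 \/ s' = -1.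
Hypothesis orient : forall e, 0 < s * detp (vsub (ipt C (fv e 1)) (cen C (fv e 0)))
               (vsub (cen C (fv e (inord 2))) (cen C (fv e 0))).
Hypothesis orient' : forall e, 0 < s' * detp (vsub (ipt Ct (fv e 1)) (cen Ct (fv e 0)))
               (vsub (cen Ct (fv e (inord 2))) (cen Ct (fv e 0))).

Lemma face_sign e i j : white (fv e i) -> ~~ white (fv e j) ->
  0 < s * s' * (det3 (P (fv e i)) (P (fv e j)) (P (fv e (nxt (nxt i)))) *
                det3 (P' (fv e i)) (P' (fv e j)) (P' (fv e (nxt (nxt i))))).
Proof.
move=> wi bj; have [->|->] := opposite wi bj.
  have := mulr_gt0 (corner_det3 pat sub s1 orient wi) (corner_det3 patt subt s'1 orient' wi).
  by congr (0 < _); ring.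
have wn : white (fv e (nxt (nxt i))) by rewrite !(white_nxt colors) negbK.
have := mulr_gt0 (corner_det3 pat sub s1 orient wn) (corner_det3 patt subt s'1 orient' wn).
by rewrite nxt4; congr (0 < _); rewrite /det3; ring.
Qed.

Variable e0 : qF Q.
Let D := det3 (P (fv e0 0)) (P (fv e0 1)) (P (fv e0 (inord 2))).
Let D' := det3 (P' (fv e0 0)) (P' (fv e0 1)) (P' (fv e0 (inord 2))).
Let A := basis_map (P (fv e0 0)) (P (fv e0 1)) (P (fv e0 (inord 2)))
                   (P' (fv e0 0)) (P' (fv e0 1)) (P' (fv e0 (inord 2))).

Let DD' : 0 < s * s' * (D * D').
Proof.
have [c0 c1 c2 c3] := colors e0.
by have := face_sign c0 c1; rewrite nxt0 nxt1.
Qed.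

Let D_neq0 : D != 0.
Proof. by apply/eqP => D0; move: DD'; rewrite D0 mul0r mulr0 ltxx. Qed.

Let D'_neq0 : D' != 0.
Proof. by apply/eqP => D0; move: DD'; rewrite D0 !mulr0 ltxx. Qed.

Lemma layout_lor x y : lor (A x) (A y) = lor x y.
Proof.
have [c0 c1 c2 c3] := colors e0.
apply: basis_map_lor => //; split; try by apply: face_gram; rewrite ?c0 ?c2 ?eqxx ?orbT.
by rewrite lorC [RHS]lorC; apply: face_gram; rewrite c2.
Qed.

Let signs (x y : R) : 0 < s * s' * x -> 0 < s * s' * y -> 0 < x * y.
Proof. by case: s1 => ->; case: s'1 => -> *; nra. Qed.

(** The patterns may have opposite orientations. [A] multiplies determinants by [D' / D], whose sign
    [s * s'] makes up for this. *)
Let det_pos (x y z x' y' z' : pt R * R) : 0 < s * s' * (det3 x y z * det3 x' y' z') ->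
  0 < det3 (A x) (A y) (A z) * det3 x' y' z'.
Proof.
move=> h; have DD : 0 < D * D by rewrite -expr2 lt_def sqrf_eq0 D_neq0 sqr_ge0.
rewrite -(pmulr_lgt0 _ DD).
have := @basis_map_det R (P (fv e0 0)) (P (fv e0 1)) (P (fv e0 (inord 2)))
  (P' (fv e0 0)) (P' (fv e0 1)) (P' (fv e0 (inord 2))) D_neq0 x y z.
rewrite -/A -/D -/D' => dE.
have -> : det3 (A x) (A y) (A z) * det3 x' y' z' * (D * D) =
    (det3 (A x) (A y) (A z) * D) * (det3 x' y' z' * D) by ring.
rewrite dE; have := signs h DD'; congr (0 < _); ring.
Qed.

Let matched v := A (P v) = P' v.

(** The edge determines the opposite centre, since its two vectors have Gram determinant -1; the two
    centres then determine the other intersection point. *)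
Lemma layout_face e i j : white (fv e i) -> ~~ white (fv e j) ->
  matched (fv e i) -> matched (fv e j) -> forall l, matched (fv e l).
Proof.
move=> wi bj mi mj; set o := nxt (nxt i).
have wo : white (fv e o) by rewrite !(white_nxt colors) negbK.
have mo : matched (fv e o).
  apply: (@lor_unique _ (P' (fv e i)) (P' (fv e j))).
  - rewrite (lor_white patt wi) (lor_black patt subt bj) (lor_white_black patt subt wi bj).
    by rewrite (_ : _ - _ = -1) ?oppr_eq0 ?oner_eq0//; ring.
  - by rewrite -mi layout_lor mi face_gram// wi.
  - by rewrite -mj layout_lor mj lorC [RHS]lorC face_gram// wo.
  - by rewrite layout_lor face_gram// wo.
  - by rewrite -{1}mi -{1}mj; apply: det_pos; exact: face_sign.
have bk : ~~ white (fv e (nxt (nxt j))) by rewrite !(white_nxt colors) negbK.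
have mk : matched (fv e (nxt (nxt j))).
  apply: (@lor_unique _ (P' (fv e i)) (P' (fv e o))).
  - rewrite (lor_white patt wi) (lor_white patt wo) (lor_white_white patt wi).
    have k1 := kap_gt1 patt subt wi; have k2 := kap_gt1 patt subt wo.
    have /andP[a0 api] := alpha_bounds e.
    have c1 : cos (alpha e) < 1.
      have sa : 0 < sin (alpha e) by apply: sin_gt0_pi; rewrite a0.
      by have := cos2Dsin2 (alpha e); nra.
    rewrite -/o; set k := kap Ct (fv e i) in k1 *; set k' := kap Ct (fv e o) in k2 *.
    have kk : 1 < k * k' by nra.
    (* The Gram determinant of the two centres is negative because [(1 - k ^ 2) (1 - k' ^ 2) = (k k'
       - 1) ^ 2 - (k - k') ^ 2]. *)
    have : (k * k' - 1) ^+ 2 < (k * k' - cos (alpha e)) ^+ 2 by rewrite -subr_gt0 subr_sqr; apply: mulr_gt0; lra.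
    have := sqr_ge0 (k - k'); rewrite sqrrN => h1 h2; apply: ltr0_neq0.
    by lra.
  - by rewrite -mi layout_lor mi face_gram// wi.
  - by rewrite -mo layout_lor mo face_gram// wo.
  - by rewrite layout_lor face_gram// eqxx orbT.
  - rewrite -{1}mi -{1}mo; apply: det_pos; have := face_sign wi bk; congr (0 < _).
    by rewrite /det3 -/o; ring.
by move=> l; have [->|->|->|->] := face_indices l wi bj.
Qed.

Lemma layout v : matched v.
Proof.
have [_ [_ [_ [[_ vface] _]]]] := disc; have [e [i <-]] := vface v; move: i.
apply: (@face_connected R Q disc (fun e => forall i, matched (fv e i)) e0).
  have [c0 c1 _ _] := colors e0.
  by apply: (@layout_face e0 0 1) => //; [exact: basis_map1|exact: basis_map2].
move=> f f' mf [i [j [i' [j' [wi bj ii' jj']]]]].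
by apply: (@layout_face f' i' j'); rewrite -?ii' -?jj'.
Qed.

(** A Lorentz isometry might exchange the two sheets. This one maps the future vector of a white
    vertex to a future vector, and [future_lor] transfers this to [u]. *)
Lemma layout_hyperboloid u : hyperboloid u -> hyperboloid (A u).
Proof.
have [c0 _ _ _] := colors e0; have k1 := kap_gt1 pat sub c0.
move=> [uu u0]; split; first by rewrite layout_lor.
have nn : lor (P (fv e0 0)) (P (fv e0 0)) < 0 by rewrite lor_white//; nra.
have nn' : lor (P' (fv e0 0)) (P' (fv e0 0)) < 0 by rewrite -layout layout_lor.
apply/(@future_lor _ _ (P' (fv e0 0))) => //; [by rewrite layout_lor uu; lra|exact: white_future|].
rewrite -layout layout_lor; apply/future_lor => //; [by rewrite uu; lra|exact: white_future].
Qed.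

Definition layout_map (z : pt R) : pt R := proj_pt (A (lift_pt z)).

Lemma layout_map_udisc z : udisc R z -> udisc R (layout_map z).
Proof. by move=> /lift_hyperboloid /layout_hyperboloid /proj_hyperboloid[]. Qed.

Lemma lift_layout_map z : udisc R z -> lift_pt (layout_map z) = A (lift_pt z).
Proof. by move=> /lift_hyperboloid /layout_hyperboloid /proj_hyperboloid[]. Qed.

Lemma layout_mapK z : udisc R z ->
  proj_pt (basis_map (P' (fv e0 0)) (P' (fv e0 1)) (P' (fv e0 (inord 2)))
                     (P (fv e0 0)) (P (fv e0 1)) (P (fv e0 (inord 2)))
                     (lift_pt (layout_map z))) = z.
Proof. by move=> zD; rewrite lift_layout_map// basis_mapK// lift_ptK. Qed.

Lemma layout_map_hdist z w : udisc R z -> udisc R w ->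
  hdist (layout_map z) (layout_map w) = hdist z w.
Proof.
move=> zD wD; rewrite !hdist_lor//; try exact: layout_map_udisc.
by rewrite !lift_layout_map// layout_lor.
Qed.

Lemma layout_map_circle v z : white v -> udisc R z ->
  circle Ct v (layout_map z) <-> circle C v z.
Proof.
move=> wv zD; rewrite /circle /=.
have fD := layout_map_udisc zD.
have h1 := lor_circle_lift (cen C v) (rad_gt0 pat wv) zD.
have h2 := lor_circle_lift (cen Ct v) (rad_gt0 patt wv) fD.
rewrite h1 h2 -!/(kap _ v) -kapE// lift_layout_map//.
have := layout v; rewrite /matched /vertex_vec wv => <-.
by rewrite layout_lor.
Qed.

End TwoPatterns.
End Layout.

Theorem theorem1p1 (R : realType) (Q : quad_graph R) (alpha : qF Q -> R)
    (C Ct : cpattern Q) :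
  bquad_graph_of_disc Q -> admissible alpha ->
  circle_pattern C alpha -> embedded C -> locally_finite_in_disc C ->
  contained_in_disc C ->
  circle_pattern Ct alpha -> embedded Ct -> locally_finite_in_disc Ct ->
  contained_in_disc Ct ->
  exists2 f : pt R -> pt R, hyp_isometry f &
    forall v, qwhite Q v -> circle Ct v = f @` circle C v.
Proof.
move=> disc adm pat emb fin sub patt embt fint subt.
have kapE v : qwhite Q v -> kap C v = kap Ct v.
  move=> wv; apply/eqP; rewrite eq_le.
  rewrite (kappa_le disc adm pat emb fin sub patt embt subt wv).
  by rewrite (kappa_le disc adm patt embt fint subt pat emb sub wv).
have kapE' v : qwhite Q v -> kap Ct v = kap C v by move=> wv; rewrite kapE.
have [colors [_ [_ [_ [cover _]]]]] := disc.
have [e0 _] : exists e0 : qF Q, True.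
  have : udisc R (0, 0) by rewrite /udisc /dotp /= mul0r addr0 ltr01.
  by rewrite -cover => -[e0 _ _]; exists e0.
have [s s1 orient] := pattern_orientation colors pat.
have [s' s'1 orient'] := pattern_orientation colors patt.
(* Exchanging the patterns gives the inverse map, hence surjectivity and the reverse inclusion of
   circles. *)
pose f := layout_map C Ct e0; pose g := layout_map Ct C e0.
have fD := layout_map_udisc disc adm pat sub patt subt kapE s1 s'1 orient orient' e0.
have gD := layout_map_udisc disc adm patt subt pat sub kapE' s'1 s1 orient' orient e0.
have gK w : udisc R w -> f (g w) = w.
  exact: (layout_mapK disc adm patt subt pat sub kapE' s'1 s1 orient' orient e0).
exists f; first split.
- exact: fD.
- by move=> w wD; exists (g w); [exact: gD|exact: gK].
- exact: (layout_map_hdist disc adm pat sub patt subt kapE s1 s'1 orient orient' e0).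
move=> v wv; rewrite eqEsubset; split=> [w vw|_ [z vz <-]].
  have wD := subt v wv w vw; exists (g w); last exact: gK.
  exact: (layout_map_circle disc adm patt subt pat sub kapE' s'1 s1 orient' orient e0 wv wD).2.
have zD := sub v wv z vz.
exact: (layout_map_circle disc adm pat sub patt subt kapE s1 s'1 orient orient' e0 wv zD).2.
Qed.
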